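(* Let $\mathcal{G}=(\mathcal{V},\mathcal{E},\mathcal{L})$ be a deterministic, primitive labelled graph with binary edge labels (label length $s=1$) presenting the constrained system $\mathcal{S}$. With $\mathrm{Cap}(\mathcal{S})$, $R_{\rm GV}$, $\Lambda(y;\mathbf{B})$, $\delta(y)$ and $\delta_{\max}$ as defined in the context, define for $y\in[0,1]$ $$\rho_{\rm GV}(y)\triangleq 2\,\mathrm{Cap}(\mathcal{S})+\delta(y)\log y-\log\Lambda(y;\mathbf{B}).$$ Then the GV curve $\mathcal{GV}(\mathcal{S})\triangleq\{(\delta,R_{\rm GV}(\delta)):\delta\in[0,1]\}$ is given by $$\mathcal{GV}(\mathcal{S})=\{(\delta(y),\rho_{\rm GV}(y)):y\in[0,1]\}\cup\{(\delta,0):\delta\ge\delta_{\max}\}.$$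
   Context: $\Sigma=\{0,1\}$. $\mathcal{G}=(\mathcal{V},\mathcal{E},\mathcal{L})$ is a finite directed graph (parallel edges allowed) with edge labelling $\mathcal{L}:\mathcal{E}\to\Sigma$; it is deterministic (outgoing edges of each state carry distinct labels) and primitive. $\mathcal{S}$ is the set of words obtained by reading labels along paths of $\mathcal{G}$, and $\mathcal{S}_n$ the set of its words of length $n$. $\log$ is to a fixed base (base 2). $\mathrm{Cap}(\mathcal{S})=\limsup_{n\to\infty}\frac1n\log|\mathcal{S}_n|$. For $\mathbf{x}\in\mathcal{S}_n$ let $V(\mathbf{x},r)=|\{\mathbf{y}\in\mathcal{S}_n:d_H(\mathbf{x},\mathbf{y})\le r\}|$ ($d_H$ = Hamming distance), $T(n,d)=\sum_{\mathbf{x}\in\mathcal{S}_n}V(\mathbf{x},d-1)$, $\widetilde T(\delta)=\limsup_{n\to\infty}\frac1n\log T(n,\lfloor\delta n\rfloor)$, and $R_{\rm GV}(\delta)=2\,\mathrm{Cap}(\mathcal{S})-\widetilde T(\delta)$. Distance matrix: $\mathbf{T}(y)$ is indexed by $\mathcal{V}\times\mathcal{V}$, with $((u,u'),(v,v'))$-entry $\sum y^{d_H(\mathcal{L}(e),\mathcal{L}(e'))}$, the sum over pairs of edges $e:u\to v$, $e':u'\to v'$ (zero if there are none). Fix an ordering $v_1,\dots,v_M$ of $\mathcal{V}$ and let $\mathcal{V}^{(2)}=\{(v_i,v_j):1\le i\le j\le M\}$. The reduced distance matrix $\mathbf{B}_{\mathcal{G}\times\mathcal{G}}(y)$ is indexed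 by $\mathcal{V}^{(2)}$, with $((v_i,v_j),(v_k,v_\ell))$-entry equal to $\mathbf{T}(y)_{(v_i,v_j),(v_k,v_\ell)}+\mathbf{T}(y)_{(v_i,v_j),(v_\ell,v_k)}$ if $k<\ell$ and $\mathbf{T}(y)_{(v_i,v_j),(v_k,v_k)}$ if $k=\ell$. $\Lambda(y;\mathbf{B})$ denotes the dominant (largest) eigenvalue of $\mathbf{B}_{\mathcal{G}\times\mathcal{G}}(y)$, and $\Lambda'(y;\mathbf{B})$ its derivative in $y$. $\delta(y)\triangleq y\Lambda'(y;\mathbf{B})/\Lambda(y;\mathbf{B})$ and $\delta_{\max}\triangleq\delta(1)=\Lambda'(1;\mathbf{B})/\Lambda(1;\mathbf{B})$. At $y=0$ the term $\delta(0)\log 0$ is interpreted as $0$.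
   Formalization: The radius d-1 is taken as 0 when d=0 (literally T(n,0)=0 and R_GV(0) would be infinite, contradicting the point at y=0), and the second piece is read as δ_max ≤ δ ≤ 1, since the curve has only δ in [0,1]. *)

(* Defs.v *)
From HB Require Import structures.
From mathcomp Require Import all_boot all_order all_algebra.
From mathcomp Require Import all_classical all_reals all_analysis.
Set Implicit Arguments. Unset Strict Implicit. Unset Printing Implicit Defensive.
Import Order.TTheory GRing.Theory Num.Theory.
Local Open Scope ring_scope.

(* A labelled graph: vertices 'I_M (this fixes the ordering v_1,...,v_M),
   a finite edge type E (parallel edges allowed), source / target maps and a
   binary label map (Sigma = {0,1} = bool). *)

Section GV.
Variables (R : realType) (M : nat) (E : finType)
  (src tgt : E -> 'I_M) (lab : E -> bool).

Definition log2 (x : R) : R := ln x / ln 2.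

Definition deterministic : Prop :=
  forall e e' : E, src e = src e' -> lab e = lab e' -> e = e'.

Definition adjmx : 'M[int]_M :=
  \matrix_(u, v) (#|[set e : E | (src e == u) && (tgt e == v)]|)%:Z.

Definition primitive : Prop :=
  (0 < M)%N /\ exists k : nat, (0 < k)%N /\ forall u v, 0 < (adjmx ^+ k) u v.

Definition is_walk n (p : n.-tuple E) : bool :=
  [forall i : 'I_n, forall j : 'I_n,
     (nat_of_ord j == (nat_of_ord i).+1) ==> (tgt (tnth p i) == src (tnth p j))].

Definition Sn n : {set n.-tuple bool} :=
  [set w | [exists p : n.-tuple E, is_walk p && (w == map_tuple lab p)]].

Definition dH n (x y : n.-tuple bool) : nat :=
  #|[set i : 'I_n | tnth x i != tnth y i]|.

Definition Vball n (x : n.-tuple bool) (r : nat) : nat :=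
  #|[set y in Sn n | (dH x y <= r)%N]|.

(* T(n, d) = sum_{x in S_n} V(x, d-1)   (d-1 truncated at 0) *)
Definition Tnd n (d : nat) : nat := (\sum_(x in Sn n) Vball x d.-1)%N.

Definition Cap : \bar R :=
  limn_esup (fun n : nat => (log2 (#|Sn n|)%:R / n%:R)%:E).

Definition Ttilde (delta : R) : \bar R :=
  limn_esup (fun n : nat =>
    (log2 (Tnd n `|Num.floor (delta * n%:R)|%N)%:R / n%:R)%:E).

Definition R_GV (delta : R) : \bar R := (2%:E * Cap - Ttilde delta)%E.

Definition Tmat (y : R) (p q : 'I_M * 'I_M) : R :=
  \sum_(e : E | (src e == p.1) && (tgt e == q.1))
   \sum_(e' : E | (src e' == p.2) && (tgt e' == q.2))
     y ^+ (lab e != lab e').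

Definition V2 : {set 'I_M * 'I_M} :=
  [set p : 'I_M * 'I_M | (nat_of_ord p.1 <= nat_of_ord p.2)%N].

Definition Bentry (y : R) (p q : 'I_M * 'I_M) : R :=
  if (nat_of_ord q.1 < nat_of_ord q.2)%N
  then Tmat y p (q.1, q.2) + Tmat y p (q.2, q.1)
  else Tmat y p (q.1, q.1).

Definition Bmx (y : R) : 'M[R]_#|V2| :=
  \matrix_(i, j) Bentry y (enum_val i) (enum_val j).

Definition Lam (y : R) : R := sup [set l : R | eigenvalue (Bmx y) l].

Definition delta_of (y : R) : R := y * derive1 Lam y / Lam y.

Definition delta_max : R := derive1 Lam 1 / Lam 1.

(* rho_GV(y) = 2 Cap + delta(y) log y - log Lambda(y)
   (ln 0 = 0 in MathComp-Analysis, so delta(0) log 0 = 0) *)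
Definition rho_GV (y : R) : \bar R :=
  (2%:E * Cap + (delta_of y * log2 y - log2 (Lam y))%:E)%E.

End GV.

(* Main.v *)
(* By determinism, the number of pairs of words of length [n] at distance [k]
   is, up to constant factors, the coefficient of [y ^ k] in the sum of the
   entries of [T(y) ^ n].  For [y > 0] the matrix [T(y)] is nonnegative with a
   positive power, so it has a positive eigenvector; symmetrizing it under the
   exchange of the two coordinates shows that [Lambda(y; B)] is the Perron root
   of [T(y)].  That root is differentiable in [y], so
   [f(t) = ln Lambda(e^t; B)] is the limiting logarithmic moment generating
   function of the distance, with slope [f'(t) = delta(e^t)].  Exponential
   tilting then gives [ln T(n, delta n) / n --> f(t) - delta t] whenever
   [delta = f'(t)] and [t <= 0], and [--> f(0)] beyond the slope at [0]. *)

Require Import Defs.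
From HB Require Import structures.
From mathcomp Require Import all_boot all_order all_algebra.
From mathcomp Require Import all_classical all_reals all_analysis.
From mathcomp Require Import lra ring.
Set Implicit Arguments.
Unset Strict Implicit.
Unset Printing Implicit Defensive.
Import Order.TTheory GRing.Theory Num.Theory.
Import numFieldNormedType.Exports.
Local Open Scope classical_set_scope.
Local Open Scope ring_scope.

(** * Perron-Frobenius theory *)

(** Two degenerate situations shape the proof. At [y = 0], determinism keeps the walks of T(0) that
    start on the diagonal of V x V on the diagonal, so no power of T(0) is positive once there are
    two states. Lambda(0; B) is therefore computed by hand: it is the Perron root [lam] of the
    adjacency matrix, whose logarithm is the capacity, in agreement with T(n, 0) = |S_n|. The slope
    delta(y) can also vanish at some [y > 0] (a single loop), where tilting has no smaller slope to
    work with. The only regularity established for [f] is differentiability. Intermediate slopes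
    come from Darboux's theorem rather than from continuity of delta, supporting lines of [f] are
    read off the tilted sums, and positive eigenvectors give growth bounds up to constants, which
    replace a spectral gap. The bound [ln lam <= f t] for [t <= 0] forces small slopes far to the
    left, so delta(y) takes every value between 0 and delta_max. *)

Lemma continuous_rowform (R : realType) n (c : 'I_n -> R) :
  continuous (fun x : 'rV[R]_n => \sum_i x 0 i * c i).
Proof.
refine (@continuous_big R _ +%R 0 xpredT _ _ _ _ _) => [|i _ x].
  exact: (@add_continuous R).
apply: (@continuousM R _ (fun z : 'rV[R]_n => z 0 i) (fun=> c i)).
  exact: coord_continuous.
exact: cst_continuous.
Qed.

Lemma continuous_mulmx_row (R : realType) m n (A : 'M[R]_(m, n)) j :
  continuous (fun x : 'rV[R]_m => (x *m A) 0 j).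
Proof.
rewrite (_ : (fun _ => _) = fun x : 'rV[R]_m => \sum_i x 0 i * A i j).
  exact: continuous_rowform.
by apply/funext => x; rewrite mxE.
Qed.

Lemma bigmin_continuous_at (R : realType) (T : topologicalType) (I : Type)
    (r : seq I) (F : I -> T -> R) (c : T -> R) (x : T) :
  continuous_at x c -> (forall i, continuous_at x (F i)) ->
  continuous_at x (fun z => \big[Num.min/c z]_(i <- r) F i z).
Proof.
move=> cc cF; elim: r => [|i r IH]; first by under eq_fun do rewrite big_nil.
under eq_fun do rewrite big_cons.
by apply: continuous_min; [exact: cF | exact: IH].
Qed.

Lemma simplex_compact (R : realType) n :
  compact [set x : 'rV[R]_n | (forall i, 0 <= x 0 i <= 1) /\ \sum_i x 0 i = 1].
Proof.
rewrite [X in compact X](_ : _ =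
  [set x : 'rV[R]_n | forall i, x 0 i \in `[0, 1]] `&`
  ((fun x : 'rV[R]_n => \sum_i x 0 i * 1) @^-1` [set 1])); last first.
  apply/seteqP; split => x /= [H1 H2]; split.
  - by move=> i; rewrite in_itv /=.
  - by under eq_bigr do rewrite mulr1.
  - by move=> i; have := H1 i; rewrite in_itv.
  - by move: H2; under eq_bigr do rewrite mulr1.
apply: compact_closedI; first last.
  apply: preimage_closed; last exact: closed_eq.
  by move=> x _; exact: continuous_rowform.
apply: (@rV_compact R n (fun=> `[0, 1]%classic)) => _.
exact: segment_compact.
Qed.

(* Collatz-Wielandt: maximize [min_j (v K)_j / v_j] over the image [v = x N] of
   the simplex.  Were [v K - mu v] nonzero at the maximum, applying the positive
   matrix [N], which commutes with [K], would strictly improve the minimum. *)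
Lemma perron_row (R : realType) n (K N : 'M[R]_n.+1) :
  (forall i j, 0 <= K i j) -> (forall i j, 0 < N i j) -> N *m K = K *m N ->
  exists mu (v : 'rV[R]_n.+1),
    [/\ 0 <= mu, forall j, 0 < v 0 j & v *m K = mu *: v].
Proof.
move=> K0 N0 NK.
pose S := [set x : 'rV[R]_n.+1 | (forall i, 0 <= x 0 i <= 1) /\ \sum_i x 0 i = 1].
have posN (w : 'rV[R]_n.+1) : (forall i, 0 <= w 0 i) -> w != 0 ->
    forall j, 0 < (w *m N) 0 j.
  move=> w0 wn0 j; rewrite mxE.
  have /rV0Pn[i wi] := wn0.
  rewrite (bigD1 i)//= ltr_pwDl// ?mulr_gt0// ?lt0r ?wi ?w0//.
  by apply: sumr_ge0 => k _; rewrite mulr_ge0// ltW.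
have SN x : S x -> forall j, 0 < (x *m N) 0 j.
  move=> [x0 x1]; apply: posN => [i|]; first by case/andP: (x0 i).
  apply/eqP => xe; move: x1; rewrite xe big1; last by move=> i _; rewrite mxE.
  by move/eqP; rewrite eq_sym oner_eq0.
(* Evaluating on [x N] instead of [x] keeps the denominators positive on the whole simplex, boundary
   included, so the minimum of the quotients is continuous there. *)
pose q (x : 'rV[R]_n.+1) j := (x *m (N *m K)) 0 j / (x *m N) 0 j.
pose g x := \big[Num.min/q x ord0]_j q x j.
have gq x j : g x <= q x j by exact: bigmin_le.
have S0 : S (\row_j (j == ord0)%:R).
  split=> [i|]; first by rewrite mxE; case: eqP; rewrite ?lexx ?ler01.
  rewrite (bigD1 ord0)//= mxE eqxx big1 ?addr0// => i i0.
  by rewrite mxE (negbTE i0).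
have [||x /set_mem Sx xmax] := @EVT_max_rV R n.+1 g S _ (@simplex_compact R n.+1).
- by exists (\row_j (j == ord0)%:R).
- apply: continuous_in_subspaceT => x /set_mem Sx.
  have cq j : continuous_at x (q ^~ j).
    apply: (@continuousM R _ (fun z : 'rV[R]_n.+1 => (z *m (N *m K)) 0 j)
                             (fun z => ((z *m N) 0 j)^-1)).
      exact: continuous_mulmx_row.
    apply: (@continuousV R _ (fun z : 'rV[R]_n.+1 => (z *m N) 0 j)).
      by rewrite gt_eqF// SN.
    exact: continuous_mulmx_row.
  exact: bigmin_continuous_at.
have vp := SN x Sx; set v := x *m N in vp.
have q0 j : 0 <= q x j.
  rewrite /q mulmxA divr_ge0 ?(ltW (vp _))// mxE sumr_ge0// => i _.
  by rewrite mulr_ge0// ltW ?vp.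
exists (g x), v; split=> //; first by apply/bigmin_geP; split.
apply/eqP; apply: contraT; rewrite -subr_eq0 => wn0.
have w0 i : 0 <= (v *m K - g x *: v) 0 i.
  rewrite mxE [X in _ + X]mxE [X in _ - X]mxE /v -mulmxA subr_ge0.
  by rewrite -ler_pdivlMr ?gq ?vp.
pose s := \sum_i v 0 i.
have s0 : 0 < s.
  by rewrite /s (bigD1 ord0)//= ltr_pwDl// sumr_ge0// => i _; exact: ltW.
have Sv : S (s^-1 *: v).
  have e i : (s^-1 *: v) 0 i = v 0 i / s by rewrite mxE mulrC.
  split=> [i|]; last by under eq_bigr do rewrite e; rewrite -mulr_suml divff ?gt_eqF.
  rewrite e divr_ge0 ?(ltW s0) ?(ltW (vp _))//= ler_pdivrMr// mul1r /s (bigD1 i)//= lerDl.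
  by apply: sumr_ge0 => k _; exact: ltW.
have := xmax (s^-1 *: v); rewrite inE => /(_ Sv); rewrite leNgt => /negP; case.
have lt j : g x < q (s^-1 *: v) j.
  rewrite /q ltr_pdivlMr ?SN// -subr_gt0.
  have := posN _ w0 wn0 j.
  rewrite -(@pmulr_lgt0 _ s^-1) ?invr_gt0//.
  rewrite mulmxBl -mulmxA -NK -!scalemxAl !mxE; nra.
by apply/bigmin_gtP; split.
Qed.

(** The transposed power of [K] is positive and commutes with [K^T]. Fixing the sum of the entries
    to 1 selects one vector on the Perron ray, so that eigenvectors at different parameters can be
    compared. *)
Lemma perron_col (R : realType) n (K : 'M[R]_n) k :
  (0 < n)%N -> (forall i j, 0 <= K i j) -> (forall i j, 0 < (K ^+ k) i j) ->
  exists mu (v : 'cV[R]_n), [/\ 0 <= mu, forall i, 0 < v i 0,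
    \sum_i v i 0 = 1 & K *m v = mu *: v].
Proof.
case: n K => // n K _ K0 Kk.
have [|||mu [v [mu0 v0 vK]]] := @perron_row R n K^T ((K ^+ k)^T).
- by move=> i j; rewrite mxE.
- by move=> i j; rewrite mxE.
- by rewrite -!trmx_mul; congr (_^T); exact: commrX.
have s0 : 0 < \sum_i v 0 i.
  by rewrite (bigD1 ord0)//= ltr_pwDl// sumr_ge0// => i _; exact: ltW.
exists mu, ((\sum_i v 0 i)^-1 *: v^T); split=> //.
- by move=> i; rewrite !mxE mulr_gt0// invr_gt0.
- under eq_bigr do rewrite !mxE.
  by rewrite -mulr_sumr mulVf// gt_eqF.
- by rewrite -scalemxAr -[K]trmxK -trmx_mul vK linearZ /= !scalerA mulrC.
Qed.

Lemma expr_trmx (R : comPzRingType) n (K : 'M[R]_n) k : (K^T) ^+ k = (K ^+ k)^T.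
Proof.
elim: k => [|k IH]; first by rewrite !expr0 trmx1.
by rewrite exprS exprSr IH -!mulmxE trmx_mul.
Qed.

(** The transpose yields a positive left eigenvector [l] for some [nu]; evaluating [l K v] in two
    ways gives [nu = mu], because [l v] is positive. *)
Lemma perron_left (R : realType) n (K : 'M[R]_n) k mu (v : 'cV[R]_n) :
  (0 < n)%N -> (forall i j, 0 <= K i j) -> (forall i j, 0 < (K ^+ k) i j) ->
  (forall i, 0 < v i 0) -> K *m v = mu *: v ->
  exists2 l : 'rV[R]_n, forall j, 0 < l 0 j & l *m K = mu *: l.
Proof.
move=> n0 K0 Kk v0 Kv.
have [||nu [l [_ l0 _ lK]]] := @perron_col R n K^T k n0.
- by move=> i j; rewrite mxE.
- by move=> i j; rewrite expr_trmx mxE.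
have lK' : l^T *m K = nu *: l^T by rewrite -[K]trmxK -trmx_mul lK linearZ.
exists l^T => [j|]; first by rewrite mxE.
rewrite lK'; congr (_ *: _); apply/eqP.
have : l^T *m K *m v = mu *: (l^T *m v) by rewrite -mulmxA Kv scalemxAr.
rewrite lK' -scalemxAl.
move/matrixP/(_ 0 0); rewrite !mxE => /mulIf/eqP; apply.
rewrite gt_eqF//; case: n n0 l l0 v v0 {K K0 Kk Kv lK lK'} => // n _ l l0 v v0.
rewrite (bigD1 ord0)//= ltr_pwDl ?mxE ?mulr_gt0// sumr_ge0// => i _.
by rewrite mxE mulr_ge0 ?ltW.
Qed.

(** Subtract from [v] the largest multiple of [r] that leaves a nonnegative vector [w]. Then [w] has
    a zero entry, and so has [K^k w = mu^k w]; positivity of [K^k] forces [w = 0]. *)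
Lemma perron_simple (R : realType) n (K : 'M[R]_n) k mu (r v : 'cV[R]_n) :
  (forall i j, 0 < (K ^+ k) i j) -> (forall i, 0 < r i 0) ->
  K *m r = mu *: r -> K *m v = mu *: v -> exists c, v = c *: r.
Proof.
case: n K r v => [|n] K r v Kk r0 Kr Kv.
  by exists 0; apply/matrixP => -[].
pose q i := v i 0 / r i 0.
have [j _ jmin] := @Order.TotalTheory.arg_minP _ R 'I_n.+1 ord0 xpredT q isT.
exists (q j); apply/eqP; rewrite -subr_eq0; apply: contraT => wn0.
set w := v - _ in wn0.
have w0 i : 0 <= w i 0.
  rewrite mxE [X in _ + X]mxE [X in _ - X]mxE subr_ge0 -ler_pdivlMr//.
  exact: jmin.
have Kw1 : K *m w = mu *: w.
  by rewrite /w mulmxBr Kv -scalemxAr Kr scalerBr !scalerA [mu * _]mulrC.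
have Kw m : K ^+ m *m w = mu ^+ m *: w.
  elim: m => [|m IH]; first by rewrite !expr0 mul1mx scale1r.
  by rewrite exprSr -mulmxE -mulmxA Kw1 -scalemxAr IH scalerA exprS.
have wj : w j 0 = 0.
  by rewrite mxE [X in _ + X]mxE [X in _ - X]mxE /q divfK ?subrr ?gt_eqF.
have /matrixP/(_ j 0) := Kw k; rewrite [RHS]mxE wj mulr0 mxE => /eqP.
rewrite psumr_eq0; last by move=> i _; rewrite mulr_ge0// ltW.
move=> /allP all0; case/negP: wn0; apply/eqP/colP => i.
have := all0 i; rewrite mem_index_enum mulf_eq0 gt_eqF//= => /(_ isT)/eqP.
by rewrite !mxE.
Qed.

Lemma mulmx_le_bound (R : realType) m n p (A : 'M[R]_(m, n)) (v : 'M[R]_(n, p)) B :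
  (forall k j, `|v k j| <= B) ->
  forall i j, `|(A *m v) i j| <= (\sum_i \sum_k `|A i k|) * B.
Proof.
move=> vB i j; rewrite mxE (le_trans (ler_norm_sum _ _ _))//.
rewrite (bigD1 i)//= mulrDl -[leLHS]addr0 lerD//.
  rewrite mulr_suml ler_sum// => k _.
  by rewrite normrM ler_wpM2l.
case: n A v vB => [|n] A v vB.
  by rewrite big1 ?mul0r// => k _; rewrite big_ord0.
rewrite mulr_ge0// ?(le_trans (normr_ge0 _) (vB ord0 j))//.
by apply: sumr_ge0 => k _; apply: sumr_ge0.
Qed.

Lemma entries_lower_bound (R : realType) (I : finType) (f : I -> R) :
  (forall i, 0 < f i) -> exists2 m : R, 0 < m & forall i, m <= f i.
Proof.
move=> f0; exists (\big[Num.min/1]_i f i); first by apply: lt_bigmin.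
by move=> i; exact: bigmin_le.
Qed.

Lemma is_derive1_quadratic (R : realType) (f : R -> R) (y D C e : R) : 0 < e ->
  (forall z, `|z - y| < e -> `|f z - f y - (z - y) * D| <= C * (z - y) ^+ 2) ->
  is_derive y 1 f D.
Proof.
move=> e0 H.
have C0 : 0 <= C.
  have := H (y + e / 2); rewrite addrC addKr gtr0_norm ?divr_gt0//.
  rewrite ltr_pdivrMr// ltr_pMr// ltr1n => /(_ isT) /(le_trans (normr_ge0 _)).
  by rewrite pmulr_lge0// exprn_gt0// divr_gt0.
have cv : h^-1 *: (f (h *: 1 + y) - f y) @[h --> 0^'] --> D.
  apply/cvgrPdist_le => eps eps0.
  near=> h.
  have h0 : h != 0 by near: h; exact: nbhs_dnbhs_neq.
  have he : `|h| < e by near: h; apply: dnbhs0_lt.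
  have hc : `|h| < eps / (C + 1).
    by near: h; apply: dnbhs0_lt; rewrite divr_gt0// ltr_wpDl.
  have := H (h + y); rewrite addrK => /(_ he) le.
  rewrite /GRing.scale /= mulr1 -[D](mulKf h0) -mulrBr normrM normfV.
  rewrite distrC ler_pdivrMl ?normr_gt0//.
  apply: (le_trans le).
  rewrite -real_normK ?num_real// expr2 mulrA mulrC ler_wpM2l//.
  rewrite ltr_pdivlMr ?ltr_wpDl// in hc.
  by rewrite mulrC; apply: le_trans (ltW hc); rewrite ler_wpM2l// lerDl.
split; first by apply/cvg_ex; exists D.
exact/cvg_lim.
Unshelve. all: by end_near. Qed.

Lemma dot_gt0 (R : realType) n (l : 'rV[R]_n) (v : 'cV[R]_n) : (0 < n)%N ->
  (forall j, 0 < l 0 j) -> (forall i, 0 < v i 0) -> 0 < (l *m v) 0 0.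
Proof.
case: n l v => // n l v _ l0 v0; rewrite mxE (bigD1 ord0)//=.
rewrite ltr_pwDl ?mulr_gt0// sumr_ge0// => i _.
by rewrite mulr_ge0 ?ltW.
Qed.

Lemma dot_ge0 (R : realType) n (l : 'rV[R]_n) (v : 'cV[R]_n) :
  (forall j, 0 <= l 0 j) -> (forall i, 0 <= v i 0) -> 0 <= (l *m v) 0 0.
Proof. by move=> l0 v0; rewrite mxE sumr_ge0// => i _; rewrite mulr_ge0. Qed.

(* Wielandt deflation: adding the rank one matrix [r 1^T] to [K - mu] makes it
   invertible, since the kernel of [K - mu] is spanned by [r]. *)
Lemma deflation_unit (R : realType) n (K : 'M[R]_n) k mu (l : 'rV[R]_n)
    (r : 'cV[R]_n) :
  (0 < n)%N -> (forall i j, 0 < (K ^+ k) i j) ->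
  (forall j, 0 < l 0 j) -> (forall i, 0 < r i 0) ->
  l *m K = mu *: l -> K *m r = mu *: r -> \sum_i r i 0 = 1 ->
  K - mu%:M + r *m const_mx 1 \in unitmx.
Proof.
move=> n0 Kk l0 r0 lK Kr r1; rewrite -unitmx_tr unitmxE unitfE.
apply/negP => /det0P[w wn0 wM].
pose v := w^T.
have Mv : (K - mu%:M + r *m const_mx 1) *m v = 0.
  by rewrite -[LHS]trmxK trmx_mul trmxK wM trmx0.
pose s : R := \sum_i v i 0.
have sE : (const_mx 1 : 'rV[R]_n) *m v = s%:M.
  apply/matrixP => i j; rewrite !ord1 !mxE eqxx mulr1n.
  by apply: eq_bigr => k0 _; rewrite mxE mul1r.
rewrite mulmxDl -mulmxA sE mul_mx_scalar mulmxBl mul_scalar_mx in Mv.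
have s0 : s = 0.
  have := congr1 (fun X => l *m X) Mv.
  rewrite mulmxDr mulmxBr mulmxA lK -scalemxAl -scalemxAr subrr add0r mulmx0.
  rewrite -scalemxAr => /matrixP/(_ 0 0); rewrite mxE [RHS]mxE => /eqP.
  by rewrite mulf_eq0 (gt_eqF (dot_gt0 n0 l0 r0)) orbF => /eqP.
move: Mv; rewrite s0 scale0r addr0 => /eqP; rewrite subr_eq0 => /eqP Kv.
have [c vc] := perron_simple Kk r0 Kr Kv.
have c0 : c = 0.
  rewrite -s0 /s vc; under eq_bigr do rewrite mxE.
  by rewrite -mulr_sumr r1 mulr1.
by case/eqP: wn0; rewrite -[w]trmxK -/v vc c0 scale0r trmx0.
Qed.

(* With [l] the left eigenvector at [y] and [r' = r z], pairing with [l] gives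
   [(Lam z - Lam y) (l r') = (z - y) l K1 r']; the derivative is
   [l K1 r / l r], and the error is quadratic because deflation shows that
   [r' - r] is at most linear in [z - y]. *)
Lemma perron_is_derive (R : realType) n (K0 K1 : 'M[R]_n) (Lam : R -> R)
    (r : R -> 'cV[R]_n) (k : nat) (y : R) :
  (0 < n)%N -> 0 < y ->
  (forall i j, 0 <= K0 i j) -> (forall i j, 0 <= K1 i j) ->
  (forall i j, 0 < ((K0 + y *: K1) ^+ k) i j) ->
  (forall z, 0 < z -> [/\ forall i, 0 < r z i 0, \sum_i r z i 0 = 1 &
     (K0 + z *: K1) *m r z = Lam z *: r z]) ->
  exists D, [/\ is_derive y 1 Lam D, 0 <= D & y * D <= Lam y].
Proof.
move=> n0 y0 K0p K1p Kk Hr.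
pose K := K0 + y *: K1.
have Kp i j : 0 <= K i j.
  by rewrite mxE [X in _ + X]mxE addr_ge0// mulr_ge0// ltW.
have [ry0 ry1 Kr] := Hr _ y0; rewrite -/K in Kr.
have [l l0 lK] := perron_left n0 Kp Kk ry0 Kr.
have lr := dot_gt0 n0 l0 ry0.
pose D := (l *m K1 *m r y) 0 0 / (l *m r y) 0 0.
exists D; split; last 2 first.
- rewrite divr_ge0 ?(ltW lr)// -mulmxA dot_ge0// => [j|i]; first exact: ltW.
  by rewrite mxE sumr_ge0// => j _; rewrite mulr_ge0// ltW.
(* [l K r] exceeds [y (l K1 r)] by [l K0 r], which is nonnegative. This is the source of delta(y) <=
   1. *)
- rewrite /D mulrA ler_pdivrMr//.
  have -> : Lam y * (l *m r y) 0 0 = (l *m K *m r y) 0 0.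
    by rewrite -mulmxA Kr -scalemxAr [RHS]mxE.
  rewrite /K mulmxDr mulmxDl [leRHS]mxE -scalemxAr -scalemxAl.
  rewrite [X in _ <= _ + X]mxE lerDr -mulmxA dot_ge0// => [j|i].
    exact: ltW.
  by rewrite mxE sumr_ge0// => j _; rewrite mulr_ge0// ltW.
have [m m0 ml] := entries_lower_bound l0.
pose M := K - (Lam y)%:M + r y *m const_mx 1.
have Mu : M \in unitmx := deflation_unit n0 Kk l0 ry0 lK Kr ry1.
pose nrm p q (A : 'M[R]_(p, q)) := \sum_i \sum_j `|A i j|.
have nrm0 p q (A : 'M[R]_(p, q)) : 0 <= nrm p q A.
  by apply: sumr_ge0 => i _; apply: sumr_ge0.
pose c1 := nrm _ _ (l *m K1) / m.
pose c2 := c1 + nrm _ _ K1.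
pose c3 := nrm _ _ (invmx M) * c2.
pose P := l *m K1 - D *: l.
apply: (is_derive1_quadratic (C := nrm _ _ P * c3 / m) y0) => z zy.
have z0 : 0 < z by move: zy; rewrite ltr_norml; lra.
have [rz0 rz1 Kz] := Hr _ z0.
set h := z - y.
have KzE : K0 + z *: K1 = K + h *: K1.
  by rewrite /K /h -addrA -scalerDl [y + _]addrC subrK.
(* A lower bound uniform in [z]: since [r z] has sum 1, dividing by [l r z] costs at most the factor
   [1 / m]. *)
have lz0 : m <= (l *m r z) 0 0.
  rewrite mxE -[m]mulr1 -rz1 mulr_sumr ler_sum// => i _.
  by rewrite ler_wpM2r// ltW.
have lz1 : 0 < (l *m r z) 0 0 := lt_le_trans m0 lz0.
have rzb i (j : 'I_1) : `|r z i j| <= 1.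
  rewrite ord1 gtr0_norm// -rz1 (bigD1 i)//= lerDl sumr_ge0// => i' _.
  exact: ltW.
have E1 : (Lam z - Lam y) * (l *m r z) 0 0 = h * (l *m K1 *m r z) 0 0.
  have := congr1 (fun X => (l *m X) 0 0) Kz.
  rewrite /= KzE mulmxDl mulmxDr mulmxA lK -scalemxAl -scalemxAl -2!scalemxAr.
  by rewrite mulmxA !mxE; lra.
have b1 : `|Lam z - Lam y| <= `|h| * c1.
  rewrite /c1 mulrA ler_pdivlMr//.
  apply: (@le_trans _ _ (`|Lam z - Lam y| * (l *m r z) 0 0)).
    by rewrite ler_wpM2l.
  rewrite -[X in _ * X]gtr0_norm// -normrM E1 normrM ler_wpM2l//.
  by rewrite -[leRHS]mulr1; exact: mulmx_le_bound.
(* [W] is [(K - Lam y)] applied to [r z]. As [r z] and [r y] have equal sums, the rank one part of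
   [M] vanishes on their difference, whence [M (r z - r y) = W]; inverting [M] bounds the difference
   by a multiple of [|h|]. *)
pose W := (Lam z - Lam y) *: r z - h *: (K1 *m r z).
have Wb i (j : 'I_1) : `|W i j| <= `|h| * c2.
  rewrite mxE [X in _ + X]mxE; apply: (le_trans (ler_normB _ _)).
  rewrite /c2 mulrDr lerD// mxE normrM.
    by rewrite -[leRHS]mulr1 ler_pM.
  by rewrite ler_wpM2l// -[leRHS]mulr1; exact: mulmx_le_bound.
have MW : M *m (r z - r y) = W.
  have ME (v : 'cV[R]_n) : \sum_i v i 0 = 1 ->
      M *m v = K *m v - Lam y *: v + r y.
    move=> v1; rewrite /M mulmxDl mulmxBl mul_scalar_mx; congr (_ + _).
    rewrite -mulmxA (_ : _ *m v = 1%:M) ?mulmx1//.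
    apply/matrixP => i j; rewrite !ord1 !mxE eqxx -[RHS]v1.
    by apply: eq_bigr => k0 _; rewrite mxE mul1r.
  rewrite mulmxBr !ME// Kr subrr add0r addrK /W scalerBl.
  have -> : K = K0 + z *: K1 - h *: K1 by rewrite KzE addrK.
  rewrite mulmxBl Kz -scalemxAl.
  by rewrite addrAC.
have b3 i (j : 'I_1) : `|(r z - r y) i j| <= `|h| * c3.
  rewrite -[r z - r y](mulKmx Mu) MW /c3 mulrCA.
  exact: mulmx_le_bound.
(* [D] is chosen so that [P r y = 0]; hence only [r z - r y] enters, which supplies the second
   factor [h]. *)
have E4 : (Lam z - Lam y - h * D) * (l *m r z) 0 0 = h * (P *m (r z - r y)) 0 0.
  have Pr : (P *m r y) 0 0 = 0.
    rewrite mulmxBl -scalemxAl mxE [X in _ + X]mxE [X in _ - X]mxE /D.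
    by rewrite divfK ?subrr// gt_eqF.
  rewrite mulmxBr [X in _ = _ * X]mxE [X in _ = _ * (_ + X)]mxE Pr subr0.
  rewrite mulmxBl -scalemxAl [X in _ = _ * X]mxE [X in _ = _ * (_ + X)]mxE.
  by rewrite [X in _ = _ * (_ - X)]mxE mulrBl E1; ring.
rewrite mulrAC ler_pdivlMr//.
apply: (@le_trans _ _ (`|Lam z - Lam y - h * D| * (l *m r z) 0 0)).
  by rewrite ler_wpM2l.
rewrite -[X in _ * X]gtr0_norm// -normrM E4 normrM -(real_normK (num_real h)).
have -> : nrm _ _ P * c3 * `|h| ^+ 2 = `|h| * (nrm _ _ P * (`|h| * c3)) by ring.
by rewrite ler_wpM2l//; exact: mulmx_le_bound.
Qed.

(** * Large deviations for arrays with a differentiable limiting generating function *)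

Lemma expR_decay_near (R : realType) (eta q : R) : 0 < eta -> 0 < q ->
  \forall n \near \oo, expR (- (n%:R * eta)) <= q.
Proof.
move=> eta0 q0; near=> n.
have h : q^-1 / eta <= n%:R by near: n; exact: nbhs_infty_ger.
rewrite expRN invf_ple ?posrE ?expR_gt0//.
rewrite ler_pdivrMr// in h.
by apply: (le_trans h); apply: le_trans (expR_ge1Dx _); rewrite lerDr.
Unshelve. all: by end_near. Qed.

Lemma le_exponential_rate (R : realType) (a b c C : R) : 0 < c -> 0 < C ->
  (\forall n \near \oo, c * expR (n%:R * a) <= C * expR (n%:R * b)) -> a <= b.
Proof.
move=> c0 C0 H; rewrite leNgt; apply/negP => ba.
have ab0 : 0 < a - b by rewrite subr_gt0.
have q0 : 0 < c / (2 * C) by rewrite divr_gt0// mulr_gt0.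
near \oo => n.
have h1 : c * expR (n%:R * a) <= C * expR (n%:R * b) by near: n.
have h2 : expR (- (n%:R * (a - b))) <= c / (2 * C).
  by near: n; exact: expR_decay_near.
move: h1; rewrite -[X in C * expR X](subrK (n%:R * a)) expRD mulrA.
rewrite ler_pM2r ?expR_gt0//.
rewrite -mulrBr -opprB mulrN => /le_trans - /(_ (C * (c / (2 * C)))).
rewrite ler_pM2l// => /(_ h2).
have -> : C * (c / (2 * C)) = c / 2 by field; rewrite gt_eqF.
lra.
Unshelve. all: by end_near. Qed.

(** The asymmetry matches its uses: Chernoff bounds give the exact exponent from above, while
    tilting loses an arbitrarily small [eta] from below. *)
Lemma cvg_ln_rate (R : realType) (a : nat -> R) (L : R) :
  (exists2 C, 0 < C & forall n, a n <= C * expR (n%:R * L)) ->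
  (forall eta, 0 < eta -> exists2 c, 0 < c &
     \forall n \near \oo, c * expR (n%:R * (L - eta)) <= a n) ->
  ln (a n) / n%:R @[n --> \oo] --> L.
Proof.
move=> [C C0 aC] H; apply/cvgrPdist_le => e e0.
have e20 : 0 < e / 2 by rewrite divr_gt0.
have [c c0 ac] := H _ e20.
near=> n.
have n0 : 0 < n%:R :> R by near: n; exact: nbhs_infty_gtr.
have h1 : c * expR (n%:R * (L - e / 2)) <= a n by near: n.
have h2 := aC n.
have h3 : ln C <= n%:R * e.
  by rewrite -ler_pdivrMr//; near: n; exact: nbhs_infty_ger.
have h4 : - ln c <= n%:R * (e / 2).
  by rewrite -ler_pdivrMr//; near: n; exact: nbhs_infty_ger.
have a0 : 0 < a n by apply: lt_le_trans h1; rewrite mulr_gt0 ?expR_gt0.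
have h5 : ln c + n%:R * (L - e / 2) <= ln (a n).
  rewrite -[X in _ + X]expRK -lnM ?posrE ?expR_gt0//.
  by rewrite ler_ln ?posrE ?mulr_gt0 ?expR_gt0.
have h6 : ln (a n) <= ln C + n%:R * L.
  rewrite -[X in _ + X]expRK -lnM ?posrE ?expR_gt0//.
  by rewrite ler_ln ?posrE ?mulr_gt0 ?expR_gt0.
rewrite distrC ler_distl lerBlDr; apply/andP; split.
  by rewrite -lerBlDr ler_pdivlMr//; nra.
by rewrite ler_pdivrMr//; nra.
Unshelve. all: by end_near. Qed.

Lemma is_derive1_near (R : realType) (f : R -> R) (t D e : R) :
  is_derive t 1 f D -> 0 < e ->
  exists2 s0, 0 < s0 & forall s, 0 < s < s0 ->
    f (t + s) - f t <= s * (D + e) /\ f (t - s) - f t <= - (s * (D - e)).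
Proof.
move=> [df fD] e0.
have cv : h^-1 *: (f (h *: 1 + t) - f t) @[h --> 0^'] --> D.
  by rewrite -fD; exact: df.
have /cvgrPdist_le/(_ _ e0) := cv.
case/nbhs_ballP => s0 /= s00 H; exists s0 => // s /andP[sp ss0].
have Hs h : h != 0 -> `|h| = s -> `|f (t + h) - f t - h * D| <= s * e.
  move=> h0 hs; have hb : ball 0 s0 h by rewrite -ball_normE /= sub0r normrN hs.
  have := H h hb h0.
  rewrite /GRing.scale /= mulr1 -[D](mulKf h0) -mulrBr normrM normfV hs.
  by rewrite ler_pdivrMl// distrC [h + t]addrC mulKf.
have sn0 : s != 0 by rewrite gt_eqF.
have := Hs s sn0 (gtr0_norm sp).
have : - s != 0 by rewrite oppr_eq0.
move=> /Hs; rewrite normrN gtr0_norm// => /(_ erefl).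
by rewrite !ler_norml; nra.
Qed.

(** Darboux's theorem, which asks for no continuity of [df]: the function [f x - v x] descends at
    [a] and arrives at [b] ascending, so its minimum is interior and is a critical point. *)
Lemma derive_ivt (R : realType) (f df : R -> R) (a b v : R) :
  (forall t : R, is_derive t 1 f (df t)) -> a < b -> df a < v < df b ->
  exists2 c, a < c < b & df c = v.
Proof.
move=> Hf ab /andP[av vb].
pose g x := f x - v * x.
have Hg (t : R) : is_derive t 1 g (df t - v).
  have := Hf t => Hft; rewrite (_ : g = f - v *: (id : R -> R)) //.
  by apply: is_derive_eq; rewrite /GRing.scale /= mulr1.
have [|c /[!in_itv]/= /andP[ac cb] cmin] := @EVT_min R g a b (ltW ab).
  by apply: derivable_within_continuous => x _; case: (Hg x).
have ba2 : 0 < b - a by rewrite subr_gt0.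
have step e : 0 < e -> exists2 s : R, 0 < s & [/\ a <= a + s <= b,
    a <= b - s <= b, f (a + s) - f a <= s * (df a + e) &
    f (b - s) - f b <= - (s * (df b - e))].
  move=> e0; have [s0 s00 H0] := is_derive1_near (Hf a) e0.
  have [s1 s10 H1] := is_derive1_near (Hf b) e0.
  pose s := Num.min (b - a) (Num.min s0 s1) / 2.
  have m0 : 0 < Num.min (b - a) (Num.min s0 s1) by rewrite !lt_min ba2 s00.
  have [i1 i2 i3] : [/\ s < b - a, s < s0 & s < s1].
    have : s < Num.min (b - a) (Num.min s0 s1) by rewrite /s; lra.
    by rewrite !lt_min => /and3P[].
  have sp : 0 < s by rewrite /s divr_gt0.
  have [|h1 _] := H0 s; first by rewrite sp.
  have [|_ h2] := H1 s; first by rewrite sp.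
  by exists s => //; split=> //; lra.
have an : a != c.
  apply/eqP => ea; rewrite -ea in cmin.
  have [|s sp [asb _ h _]] := step ((v - df a) / 2); first by lra.
  have := cmin (a + s); rewrite in_itv /= => /(_ asb); rewrite /g.
  by nra.
have bn : c != b.
  apply/eqP => eb; rewrite eb in cmin.
  have [|s sp [_ asb _ h]] := step ((df b - v) / 2); first by lra.
  have := cmin (b - s); rewrite in_itv /= => /(_ asb); rewrite /g.
  by nra.
have ac' : a < c by rewrite lt_neqAle an.
have cb' : c < b by rewrite lt_neqAle bn.
exists c; first by rewrite ac'.
have gd : is_derive c 1 g 0.
  apply: (@derive1_at_min R g a b c (ltW ab)).
  - by move=> t _; case: (Hg t).
  - by rewrite in_itv/= ac'.
  - move=> t /[!in_itv]/= /andP[at' tb].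
    by apply: cmin; rewrite in_itv/= !ltW.
apply/eqP; rewrite -subr_eq0; apply/eqP.
by rewrite -(@derive_val _ _ _ _ _ _ _ gd); case: (Hg c).
Qed.

Definition gen_fun (R : realType) (W : nat -> nat -> R) (n : nat) (t : R) : R :=
  \sum_(k < n.+1) W n k * expR (t * k%:R).

(* "cgf" stands for (asymptotic) cumulant generating function. *)
Definition has_cgf (R : realType) (W : nat -> nat -> R) (f df : R -> R) : Prop :=
  [/\ forall n k, 0 <= W n k, forall t : R, is_derive t 1 f (df t) &
   forall t, exists c C, [/\ 0 < c, 0 < C & forall n,
     c * expR (n%:R * f t) <= gen_fun W n t <= C * expR (n%:R * f t)]].

Definition cumul (R : realType) (W : nat -> nat -> R) (n r : nat) : R :=
  \sum_(k < n.+1 | (k <= r)%N) W n k.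

Lemma ler_sum_cond (R : realType) (I : finType) (P : pred I) (F G : I -> R) :
  (forall i, P i -> F i <= G i) -> (forall i, 0 <= G i) ->
  \sum_(i | P i) F i <= \sum_i G i.
Proof.
move=> FG G0; rewrite big_mkcond ler_sum// => i _.
by case: ifP => // /FG.
Qed.

(* Exponential tilting: by differentiability at [t], the tilted weights with
   [k / n] away from [df t] are exponentially negligible. *)
Lemma tilted_window (R : realType) (W : nat -> nat -> R) (f df : R -> R) t e :
  has_cgf W f df -> 0 < e ->
  exists2 c, 0 < c & \forall n \near \oo, c * expR (n%:R * f t) <=
    \sum_(k < n.+1 | `|k%:R - n%:R * df t| <= n%:R * e) W n k * expR (t * k%:R).
Proof.
move=> [W0 Hf HG] e0.
have e20 : 0 < e / 2 by rewrite divr_gt0.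
have [s0 s00 /(_ (s0 / 2))[|f1 f2]] := is_derive1_near (Hf t) e20.
  by rewrite divr_gt0//=; lra.
set s := s0 / 2 in f1 f2; have sp : 0 < s by rewrite divr_gt0.
have [c [C0 [c0 _ Hc]]] := HG t.
have [c1 [C1 [_ C10 HC1]]] := HG (t + s).
have [c2 [C2 [_ C20 HC2]]] := HG (t - s).
have CC0 : 0 < C1 + C2 by rewrite addr_gt0.
have q0 : 0 < c / 2 / (C1 + C2) by rewrite !divr_gt0.
have se0 : 0 < s * (e / 2) by rewrite mulr_gt0.
exists (c / 2); first by rewrite divr_gt0.
near=> n.
have n0 : 0 <= n%:R :> R by [].
have dec : expR (- (n%:R * (s * (e / 2)))) <= c / 2 / (C1 + C2).
  by near: n; exact: expR_decay_near.
pose D := df t.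
(* Chernoff factors for the two tails: [A1 * expR (s k) >= 1] above the window and
   [A2 * expR (- s k) >= 1] below it. The derivative at [t] was approximated within [e / 2], so each
   tail loses the exponent [s e / 2] per letter. *)
pose A1 := expR (- (n%:R * (s * (D + e)))).
pose A2 := expR (n%:R * (s * (D - e))).
have split_sum : gen_fun W n t <=
  \sum_(k < n.+1 | `|k%:R - n%:R * D| <= n%:R * e) W n k * expR (t * k%:R) +
  (A1 * gen_fun W n (t + s) + A2 * gen_fun W n (t - s)).
  rewrite /gen_fun [X in _ <= X + _]big_mkcond /= !mulr_sumr -!big_split /=.
  apply: ler_sum => k _.
  have a1 : 0 <= A1 * (W n k * expR ((t + s) * k%:R)).
    by rewrite !mulr_ge0 ?expR_ge0.
  have a2 : 0 <= A2 * (W n k * expR ((t - s) * k%:R)).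
    by rewrite !mulr_ge0 ?expR_ge0.
  case: ifPn => [_|]; first by rewrite lerDl addr_ge0.
  rewrite -ltNge lter_normr add0r; case/orP => hk.
  - apply: (@le_trans _ _ (A1 * (W n k * expR ((t + s) * k%:R)))); last by rewrite lerDl.
    rewrite mulrCA ler_wpM2l// /A1 -expRD ler_expR; nra.
  - apply: (@le_trans _ _ (A2 * (W n k * expR ((t - s) * k%:R)))); last by rewrite lerDr.
    rewrite mulrCA ler_wpM2l// /A2 -expRD ler_expR; nra.
have /andP[g1 _] := Hc n; have /andP[_ g2] := HC1 n; have /andP[_ g3] := HC2 n.
have b1 : A1 * gen_fun W n (t + s) <=
    C1 * (expR (n%:R * f t) * expR (- (n%:R * (s * (e / 2))))).
  apply: (@le_trans _ _ (A1 * (C1 * expR (n%:R * f (t + s))))).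
    by rewrite ler_wpM2l ?expR_ge0.
  rewrite mulrCA ler_wpM2l ?(ltW C10)// /A1 /D -!expRD ler_expR.
  by have := ler_wpM2l n0 f1; lra.
have b2 : A2 * gen_fun W n (t - s) <=
    C2 * (expR (n%:R * f t) * expR (- (n%:R * (s * (e / 2))))).
  apply: (@le_trans _ _ (A2 * (C2 * expR (n%:R * f (t - s))))).
    by rewrite ler_wpM2l ?expR_ge0.
  rewrite mulrCA ler_wpM2l ?(ltW C20)// /A2 /D -!expRD ler_expR.
  by have := ler_wpM2l n0 f2; lra.
have b3 : (C1 + C2) * (expR (n%:R * f t) * expR (- (n%:R * (s * (e / 2))))) <=
    c / 2 * expR (n%:R * f t).
  rewrite mulrCA mulrC ler_wpM2r ?expR_ge0// mulrC.
  by rewrite -ler_pdivlMr.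
rewrite -/D; move: split_sum g1 b1 b2 b3; set S := \sum_(_ < _ | _) _.
by rewrite mulrDl; lra.
Unshelve. all: by end_near. Qed.

(** The supporting line inequality of a convex function, read off the sums: the window at [t] has
    mass of order [expR (n f t)], and there [k] is close to [n df t], so passing from [t] to [s]
    multiplies the mass by about [expR (n df t (s - t))]. *)
Lemma cgf_tangent (R : realType) (W : nat -> nat -> R) (f df : R -> R) s t :
  has_cgf W f df -> f t + df t * (s - t) <= f s.
Proof.
move=> HW; apply/ler_addgt0Pr => eta eta0.
have n1 : 0 < `|s - t| + 1 by rewrite ltr_wpDl.
pose e := eta / (`|s - t| + 1).
have e0 : 0 < e by rewrite divr_gt0.
have [c c0 Hc] := tilted_window t HW e0.
have [W0 Hf HG] := HW.
have [c' [C [_ C0 HC]]] := HG s.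
have eb : `|s - t| * e <= eta.
  by rewrite /e mulrCA ger_pMr// ler_pdivrMr// mul1r lerDl.
rewrite -lerBlDr; apply: (le_exponential_rate c0 C0).
near=> n.
have /andP[_ HCn] := HC n.
apply: le_trans HCn.
have n0 : 0 <= n%:R :> R by [].
have Hn : c * expR (n%:R * f t) <=
    \sum_(k < n.+1 | `|k%:R - n%:R * df t| <= n%:R * e) W n k * expR (t * k%:R).
  by near: n.
have -> : n%:R * (f t + df t * (s - t) - eta) =
    n%:R * f t + n%:R * (df t * (s - t) - eta) by ring.
rewrite expRD mulrA.
apply: (le_trans (ler_wpM2r (expR_ge0 _) Hn)).
rewrite mulr_suml; apply: ler_sum_cond => [k hk|k]; last first.
  by rewrite mulr_ge0 ?expR_ge0.
rewrite -mulrA ler_wpM2l// -expRD ler_expR.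
have h1 : `|(s - t) * (k%:R - n%:R * df t)| <= `|s - t| * (n%:R * e).
  by rewrite normrM ler_wpM2l.
have h2 : n%:R * (`|s - t| * e) <= n%:R * eta by rewrite ler_wpM2l.
by move: h1; rewrite ler_norml => /andP[h1 _]; lra.
Unshelve. all: by end_near. Qed.

Lemma floor_radius_le (R : realType) (d : R) (n k : nat) : 0 <= d ->
  (k <= `|Num.floor (d * n%:R)|%N.-1)%N -> k%:R <= d * n%:R.
Proof.
move=> d0 hk; have h0 : 0 <= d * n%:R by rewrite mulr_ge0.
apply: (@le_trans _ _ (Num.floor (d * n%:R))%:~R); last exact: floor_le_tmp.
rewrite -[X in X%:~R]gez0_abs ?floor_ge0//.
by rewrite -pmulrn ler_nat (leq_trans hk)// leq_pred.
Qed.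

(** The slack 2 covers both the rounding and the passage from [d] to the radius [d - 1]; it is
    harmless against windows of width linear in [n]. *)
Lemma le_floor_radius (R : realType) (d : R) (n k : nat) :
  k%:R + 2 <= d * n%:R -> (k <= `|Num.floor (d * n%:R)|%N.-1)%N.
Proof.
move=> hk; have h0 : 0 <= d * n%:R by apply: le_trans hk; rewrite addr_ge0.
have : (k.+2%:Z <= Num.floor (d * n%:R)).
  by rewrite floor_ge_int -pmulrn -natr1 -natr1; lra.
rewrite -[X in _ <= X]gez0_abs ?floor_ge0// lez_nat => h.
by rewrite -ltnS prednK ?(leq_trans _ h)// ltnW.
Qed.

(** Chernoff bound for the lower tail: since [t <= 0], every [k <= d n] satisfies
    [expR (t k) >= expR (n d t)]. *)
Lemma cumul_upper (R : realType) (W : nat -> nat -> R) (f df : R -> R) t d :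
  has_cgf W f df -> t <= 0 -> 0 <= d -> exists2 C, 0 < C & forall n,
  cumul W n `|Num.floor (d * n%:R)|%N.-1 <= C * expR (n%:R * (f t - d * t)).
Proof.
move=> [W0 Hf HG] t0 d0; have [c [C [_ C0 HC]]] := HG t.
exists C => // n; have /andP[_ HCn] := HC n.
rewrite mulrBr expRD mulrA.
apply: le_trans (ler_wpM2r (expR_ge0 _) HCn).
rewrite mulr_suml; apply: ler_sum_cond => [k hk|k]; last first.
  by rewrite !mulr_ge0 ?expR_ge0.
rewrite -mulrA -expRD ler_peMr// -[leLHS]expR0 ler_expR.
have := floor_radius_le d0 hk; nra.
Qed.

Lemma cumul_lower (R : realType) (W : nat -> nat -> R) (f df : R -> R) t d eta :
  has_cgf W f df -> t <= 0 -> df t < d -> 0 < eta -> exists2 c, 0 < c &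
  \forall n \near \oo, c * expR (n%:R * (f t - df t * t - eta)) <=
    cumul W n `|Num.floor (d * n%:R)|%N.-1.
Proof.
move=> HW t0 td eta0.
have n1 : 0 < `|t| + 1 by rewrite ltr_wpDl.
have dt0 : 0 < d - df t by rewrite subr_gt0.
(* The first bound puts the window below [d n - 2] as soon as [n >= 4 / (d - df t)]; the second
   makes removing the tilt cost at most [eta] per letter. The [+ 1] avoids a zero denominator at
   [t = 0]. *)
pose e := Num.min ((d - df t) / 2) (eta / (`|t| + 1)).
have e0 : 0 < e by rewrite lt_min !divr_gt0.
have e1 : e <= (d - df t) / 2 by rewrite ge_min lexx.
have e2 : - t * e <= eta.
  have e2' : e <= eta / (`|t| + 1) by rewrite ge_min lexx orbT.
  rewrite -ler0_norm//; apply: (le_trans (ler_wpM2l (normr_ge0 _) e2')).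
  by rewrite mulrCA ger_pMr// ler_pdivrMr// mul1r lerDl.
have [c c0 Hc] := tilted_window t HW e0.
have [W0 _ _] := HW.
exists c => //; near=> n.
have n0 : 0 <= n%:R :> R by [].
have nl : 4 / (d - df t) <= n%:R by near: n; exact: nbhs_infty_ger.
rewrite ler_pdivrMr// in nl.
have Hn : c * expR (n%:R * f t) <=
    \sum_(k < n.+1 | `|k%:R - n%:R * df t| <= n%:R * e) W n k * expR (t * k%:R).
  by near: n.
have -> : n%:R * (f t - df t * t - eta) =
    n%:R * f t + n%:R * (- (df t * t) - eta) by ring.
rewrite expRD mulrA.
apply: (le_trans (ler_wpM2r (expR_ge0 _) Hn)).
rewrite mulr_suml /cumul [leLHS]big_mkcond [leRHS]big_mkcond ler_sum// => k _.
case: ifPn => [|_]; last by case: ifP.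
rewrite ler_norml => /andP[k1 k2].
rewrite le_floor_radius; last first.
  have := ler_wpM2l n0 e1; nra.
rewrite -mulrA -expRD ler_piMr// -[leRHS]expR0 ler_expR.
have := ler_wpM2l n0 e2; nra.
Unshelve. all: by end_near. Qed.

(** A function bounded below by [m] cannot keep slope at least [d] far to the left: over the
    distance [X], the supporting line at [t - X] would rise by [f t - m + d] from a height at least
    [m], and pass above [f t]. *)
Lemma cgf_small_slope (R : realType) (W : nat -> nat -> R) (f df : R -> R) m t d :
  has_cgf W f df -> (forall s, s <= 0 -> m <= f s) -> t <= 0 -> 0 < d ->
  exists2 s, s < t & df s < d.
Proof.
move=> HW fm t0 d0; pose X := (f t - m) / d + 1.
have X0 : 0 < X by rewrite ltr_wpDl// divr_ge0 ?(ltW d0)// subr_ge0 fm.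
exists (t - X); first by rewrite ltrBlDr ltrDl.
rewrite ltNge; apply/negP => ds.
have := cgf_tangent t (t - X) HW.
have : m <= f (t - X) by apply: fm; lra.
have dX : d * X = f t - m + d by rewrite /X; field; rewrite gt_eqF.
by have := ler_wpM2r (ltW X0) ds; lra.
Qed.

Lemma cgf_slope_surj (R : realType) (W : nat -> nat -> R) (f df : R -> R) m d :
  has_cgf W f df -> (forall s, s <= 0 -> m <= f s) -> 0 < d -> d < df 0 ->
  exists2 t, t < 0 & df t = d.
Proof.
move=> HW fm d0 dd; have [_ Hf _] := HW.
have [s s0 ds] := cgf_small_slope HW fm (lexx 0) d0.
have [|t /andP[_ t0] dt] := @derive_ivt R f df s 0 d Hf s0; first by rewrite ds.
by exists t.
Qed.

(** At the critical threshold [df t] the window at [t] is only half covered, so the lower bound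
    tilts at some [t1 < t] of slightly smaller slope [df t - g], and the supporting line at [t]
    bounds the loss. Positivity of [df t] guarantees that smaller slopes exist. *)
Lemma cumul_rate_tangent (R : realType) (W : nat -> nat -> R) (f df : R -> R)
    m t :
  has_cgf W f df -> (forall s, s <= 0 -> m <= f s) -> t <= 0 -> 0 < df t ->
  ln (cumul W n `|Num.floor (df t * n%:R)|%N.-1) / n%:R @[n --> \oo]
    --> f t - df t * t.
Proof.
move=> HW fm t0 dt0.
apply: cvg_ln_rate; first exact: cumul_upper HW t0 (ltW dt0).
move=> eta eta0.
have [_ Hf _] := HW.
have [s0 s0t ds0] := cgf_small_slope HW fm t0 dt0.
have n1 : 0 < `|s0| + 1 by rewrite ltr_wpDl.
(* The first bound places [df t - g] strictly between [df s0] and [df t]; the second keeps the loss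
   [- g t1] below [eta / 2], as [t1 > s0]. *)
pose g := Num.min ((df t - df s0) / 2) (eta / 2 / (`|s0| + 1)).
have g0 : 0 < g by rewrite lt_min !divr_gt0 ?subr_gt0.
have g1 : g <= (df t - df s0) / 2 by rewrite ge_min lexx.
have g2 : - s0 * g <= eta / 2.
  have g2' : g <= eta / 2 / (`|s0| + 1) by rewrite ge_min lexx orbT.
  rewrite -ler0_norm; last by lra.
  apply: (le_trans (ler_wpM2l (normr_ge0 _) g2')).
  by rewrite mulrCA ger_pMr ?divr_gt0// ler_pdivrMr// mul1r lerDl.
have [|t1 /andP[t1l t1r] dt1] := @derive_ivt R f df s0 t (df t - g) Hf s0t.
  by lra.
have [|||c c0 Hc] := @cumul_lower R W f df t1 (df t) (eta / 2) HW; [lra..|].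
exists c => //; near=> n.
have Hn : c * expR (n%:R * (f t1 - df t1 * t1 - eta / 2)) <=
  cumul W n `|Num.floor (df t * n%:R)|%N.-1 by near: n.
apply: le_trans Hn; rewrite ler_pM2l// ler_expR ler_wpM2l// dt1.
have := cgf_tangent t1 t HW.
nra.
Unshelve. all: by end_near. Qed.

Lemma cumul_rate_top (R : realType) (W : nat -> nat -> R) (f df : R -> R) d :
  has_cgf W f df -> 0 <= d -> df 0 < d ->
  ln (cumul W n `|Num.floor (d * n%:R)|%N.-1) / n%:R @[n --> \oo] --> f 0.
Proof.
move=> HW d0 dd.
have := cumul_upper HW (lexx 0) d0; rewrite mulr0 subr0 => U.
apply: cvg_ln_rate => // eta eta0.
by have := cumul_lower HW (lexx 0) dd eta0; rewrite mulr0 subr0.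
Qed.

(** * Counting words of a deterministic graph *)

Section Words.
Variables (M : nat) (E : finType) (src tgt : E -> 'I_M) (lab : E -> bool).

Fixpoint nwalks (u : 'I_M) (w : seq bool) : nat :=
  if w is b :: w' then
    (\sum_(e | (src e == u) && (lab e == b)) nwalks (tgt e) w')%N
  else 1%N.

Fixpoint walk_from (u : 'I_M) (p : seq E) : bool :=
  if p is e :: p' then (src e == u) && walk_from (tgt e) p' else true.

Lemma nwalks_le1 u w : deterministic src lab -> (nwalks u w <= 1)%N.
Proof.
move=> det; elim: w u => //= b w IH u.
have [e /andP[/eqP eu /eqP eb]|none] := pickP (fun e => (src e == u) && (lab e == b)).
  rewrite (bigD1 e) ?eu ?eb ?eqxx//= big1 ?addn0// => e' /andP[/andP[/eqP u' /eqP b']].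
  by rewrite (det e' e) ?eqxx ?eu ?eb.
by rewrite big_pred0.
Qed.

Lemma nwalks_gt0P u w :
  reflect (exists2 p, walk_from u p & map lab p = w) (0 < nwalks u w)%N.
Proof.
elim: w u => [|b w IH] u /=; first by apply: ReflectT; exists [::].
rewrite lt0n sum_nat_eq0; apply: (iffP idP).
  move=> /forallPn[e]; rewrite negb_imply => /andP[/andP[su lb]].
  rewrite -lt0n => /IH[p pw pl]; exists (e :: p) => /=; first by rewrite su.
  by rewrite (eqP lb) pl.
case=> -[|e p] //= /andP[su pw] [lb pl].
apply/forallPn; exists e; rewrite negb_imply su lb eqxx /= -lt0n.
by apply/IH; exists p.
Qed.

Lemma walk_fromE u e p :
  walk_from u (e :: p) = (src e == u) && path (fun e e' => tgt e == src e') e p.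
Proof.
elim: p u e => //= e' p IH u e.
by have /= -> := IH (tgt e) e'; rewrite [src e' == _]eq_sym.
Qed.

Lemma is_walkE n (p : n.-tuple E) :
  is_walk src tgt p = sorted (fun e e' => tgt e == src e') p.
Proof.
case: n p => [|n] p.
  rewrite (tuple0 p) /=; apply/forallP => -[] //.
pose e0 := thead p.
apply/idP/(sortedP e0) => [/forallP H i|H].
  rewrite size_tuple => iS.
  have /forallP/(_ (Ordinal iS)) := H (Ordinal (ltnW iS)).
  by rewrite eqxx /= !(tnth_nth e0).
apply/forallP => i; apply/forallP => j; apply/implyP => /eqP ji.
by rewrite !(tnth_nth e0) ji H// size_tuple -ji.
Qed.

Lemma mem_SnP n (w : n.-tuple bool) : (0 < M)%N ->
  reflect (exists u, (0 < nwalks u w)%N) (w \in Sn src tgt lab n).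
Proof.
move=> M0; have sortedE p : sorted (fun e e' => tgt e == src e') p <->
    exists u, walk_from u p.
  case: p => [|e p]; first by split=> // _; exists (Ordinal M0).
  split=> [pw|[u]]; last by rewrite walk_fromE => /andP[].
  by exists (src e); rewrite walk_fromE eqxx.
rewrite inE; apply: (iffP existsP).
  case=> p /andP[]; rewrite is_walkE => /sortedE[u pw] /eqP ->.
  by exists u; apply/nwalks_gt0P; exists p.
case=> u /nwalks_gt0P[p pw pl].
have sz : size p == n by rewrite -(size_map lab) pl size_tuple.
exists (Tuple sz); rewrite is_walkE; apply/andP; split.
  by apply/sortedE; exists u.
by apply/eqP/val_inj.
Qed.

Definition nwords (w : seq bool) : nat := (\sum_u nwalks u w)%N.

(** Determinism leaves at most one walk per starting state, so counting walks instead of words costs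
    at most the factor [M], invisible in exponential rates. *)
Lemma nwords_bounds n (w : n.-tuple bool) : (0 < M)%N -> deterministic src lab ->
  ((w \in Sn src tgt lab n) <= nwords w <= M * (w \in Sn src tgt lab n))%N.
Proof.
move=> M0 det; have [/(mem_SnP _ M0)[u uw]|wS] := boolP (w \in Sn src tgt lab n).
  rewrite muln1 /nwords; apply/andP; split.
    by rewrite (bigD1 u)//= ltn_addr.
  rewrite -[X in (_ <= X)%N]card_ord -sum1_card leq_sum// => v _.
  exact: nwalks_le1.
rewrite muln0 leq0n leqn0 sum_nat_eq0; apply/forallP => u /=.
by rewrite -leqn0 leqNgt; apply: contra wS => uw; apply/(mem_SnP _ M0); exists u.
Qed.

End Words.

Lemma dH_cons n (b b' : bool) (x y : n.-tuple bool) :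
  dH [tuple of b :: x] [tuple of b' :: y] = ((b != b') + dH x y)%N.
Proof.
rewrite /dH -!sum1dep_card big_mkcond big_ord_recl /= !tnth0 [in RHS]big_mkcond /=.
congr (_ + _)%N.
by apply: eq_bigr => i _; rewrite !tnthS.
Qed.

Lemma dH_le n (x y : n.-tuple bool) : (dH x y <= n)%N.
Proof. by rewrite (leq_trans (max_card _))// card_ord. Qed.

Lemma dH_eq0 n (x y : n.-tuple bool) : (dH x y == 0)%N = (x == y).
Proof.
rewrite /dH cards_eq0; apply/eqP/eqP => [e0|->].
  apply/eq_from_tnth => i; apply/eqP; move/setP/(_ i): e0.
  by rewrite !inE => /negbFE.
by apply/setP => i; rewrite !inE eqxx.
Qed.

Lemma sum_tuple_cons (V : nmodType) n (F : n.+1.-tuple bool -> V) :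
  \sum_w F w = \sum_b \sum_(w : n.-tuple bool) F [tuple of b :: w].
Proof.
rewrite pair_bigA /=.
rewrite (reindex (fun p : bool * n.-tuple bool => [tuple of p.1 :: p.2])) //=.
exists (fun w => (thead w, [tuple of behead w])) => [[b w]|w] _ /=.
  by rewrite theadE; congr pair; apply/val_inj.
by rewrite [RHS]tuple_eta.
Qed.

(** * Transfer-matrix recursions for words and pairs of words *)

Section Growth.
Variables (R : realType) (M : nat) (E : finType).
Variables (src tgt : E -> 'I_M) (lab : E -> bool).

Notation walks := (nwalks src tgt lab).
Notation words := (nwords src tgt lab).

Definition word_count n (u : 'I_M) : R :=
  \sum_(w : n.-tuple bool) (walks u w)%:R.

(** The entry at [q] of T(y)^n applied to the all-ones vector, as the recursion below shows. *)
Definition pair_gf (y : R) n (q : 'I_M * 'I_M) : R :=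
  \sum_(w : n.-tuple bool) \sum_(w' : n.-tuple bool)
    (walks q.1 w)%:R * (walks q.2 w')%:R * y ^+ dH w w'.

Lemma sum_lab (F : bool -> E -> R) u :
  \sum_b \sum_(e | (src e == u) && (lab e == b)) F b e =
  \sum_(e | src e == u) F (lab e) e.
Proof.
rewrite (partition_big lab xpredT) //=; apply: eq_bigr => b _.
by apply: eq_bigr => e /andP[_ /eqP ->].
Qed.

Lemma sum_tgt (F : 'I_M -> E -> R) u :
  \sum_v \sum_(e | (src e == u) && (tgt e == v)) F v e =
  \sum_(e | src e == u) F (tgt e) e.
Proof.
rewrite (partition_big tgt xpredT) //=; apply: eq_bigr => v _.
by apply: eq_bigr => e /andP[_ /eqP ->].
Qed.

Lemma word_count0 u : word_count 0 u = 1.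
Proof.
rewrite /word_count (big_pred1 [tuple]) //= => w.
exact/esym/eqP/tuple0.
Qed.

Lemma word_countS n u :
  word_count n.+1 u = \sum_(e | src e == u) word_count n (tgt e).
Proof.
rewrite /word_count sum_tuple_cons -(sum_lab (fun _ e => word_count n (tgt e))).
apply: eq_bigr => b _; rewrite exchange_big /=; apply: eq_bigr => w _.
by rewrite natr_sum.
Qed.

Lemma pair_gf0 y q : pair_gf y 0 q = 1.
Proof.
rewrite /pair_gf (big_pred1 [tuple]) => [|w]; last exact/esym/eqP/tuple0.
rewrite (big_pred1 [tuple]) => [|w]; last exact/esym/eqP/tuple0.
by rewrite /= !mul1r (_ : dH _ _ = 0%N) ?expr0//; apply/eqP; rewrite dH_eq0.
Qed.

Lemma sum_Tmat y p (F : 'I_M * 'I_M -> R) :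
  \sum_q Tmat src tgt lab y p q * F q =
  \sum_(e | src e == p.1) \sum_(e' | src e' == p.2)
    y ^+ (lab e != lab e') * F (tgt e, tgt e').
Proof.
rewrite -(sum_tgt (fun v e => \sum_(e' | src e' == p.2)
    y ^+ (lab e != lab e') * F (v, tgt e'))).
transitivity (\sum_v \sum_v' Tmat src tgt lab y p (v, v') * F (v, v')).
  by rewrite pair_bigA; apply: eq_bigr => -[].
apply: eq_bigr => v _.
under eq_bigr do rewrite /Tmat /= mulr_suml.
rewrite exchange_big /=; apply: eq_bigr => e _.
rewrite -(sum_tgt (fun v' e' => y ^+ (lab e != lab e') * F (v, v'))).
by apply: eq_bigr => v' _; rewrite mulr_suml.
Qed.

(** Choosing the first letters and then edges carrying them amounts to choosing the first edges [e],
    [e']. Hamming distance is additive over letters, so this choice contributes exactly one term of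
    an entry of T(y); the rest is reordering of sums. *)
Lemma pair_gfS y n p :
  pair_gf y n.+1 p = \sum_q Tmat src tgt lab y p q * pair_gf y n q.
Proof.
rewrite sum_Tmat /pair_gf sum_tuple_cons.
rewrite -(sum_lab (fun b e => \sum_(e' | src e' == p.2) y ^+ (b != lab e') *
  pair_gf y n (tgt e, tgt e'))); apply: eq_bigr => b _.
under eq_bigr do rewrite sum_tuple_cons.
rewrite exchange_big /=.
under [RHS]eq_bigr => e _ do rewrite -(sum_lab (fun b' e' => y ^+ (b != b') *
  pair_gf y n (tgt e, tgt e'))).
rewrite [RHS]exchange_big /=; apply: eq_bigr => b' _.
rewrite /pair_gf.
under [RHS]eq_bigr => e _ do under eq_bigr => e' _ do
  (rewrite mulr_sumr; under eq_bigr => w _ do rewrite mulr_sumr).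
under [RHS]eq_bigr => e _ do rewrite exchange_big /=.
rewrite [RHS]exchange_big /=; apply: eq_bigr => w _.
under [RHS]eq_bigr => e _ do rewrite exchange_big /=.
rewrite [RHS]exchange_big /=; apply: eq_bigr => w' _.
rewrite dH_cons exprD !natr_sum mulr_suml mulr_suml.
apply: eq_bigr => e _; rewrite mulr_sumr mulr_suml.
by apply: eq_bigr => e' _; ring.
Qed.
End Growth.

(** * The distance matrix and its reduced form *)

(** The initial vector 1 lies between two multiples of the positive eigenvector [r], and a
    nonnegative [K] preserves this sandwich. *)
Lemma linear_growth (R : realType) (I : finType) (K : I -> I -> R) (r : I -> R)
    (mu : R) (h : nat -> I -> R) :
  (forall i j, 0 <= K i j) -> (forall i, 0 < r i) ->
  (forall i, \sum_j K i j * r j = mu * r i) ->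
  (forall i, h 0%N i = 1) -> (forall n i, h n.+1 i = \sum_j K i j * h n j) ->
  exists c C, [/\ 0 < c, 0 < C & forall n i, c * mu ^+ n <= h n i <= C * mu ^+ n].
Proof.
move=> K0 r0 Kr h0 hS.
have [m m0 mr] := entries_lower_bound r0.
have [m' m'0 m'r] := @entries_lower_bound R I (fun i => (r i)^-1)
  (fun i => ltac:(by rewrite invr_gt0)).
have [i0 _|noI] := pickP (@predT I); last first.
  by exists 1, 1; split=> // n i; have := noI i.
have rM i : r i <= m'^-1 by rewrite -[r i]invrK lef_pV2 ?posrE ?invr_gt0.
have mu0 : 0 <= mu.
  rewrite -(pmulr_lge0 _ (r0 i0)) -Kr sumr_ge0// => j _.
  by rewrite mulr_ge0// ltW.
have bnd n i : m' * r i * mu ^+ n <= h n i <= m^-1 * r i * mu ^+ n.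
  elim: n i => [|n IH] i.
    rewrite h0 expr0 !mulr1; apply/andP; split.
      by rewrite -ler_pdivlMl// mulr1.
    by rewrite mulrC ler_pdivlMr// mul1r.
  have e (a : R) : a * r i * mu ^+ n.+1 = \sum_j K i j * (a * r j * mu ^+ n).
    have -> : a * r i * mu ^+ n.+1 = a * mu ^+ n * (mu * r i) by rewrite exprS; ring.
    by rewrite -Kr mulr_sumr; apply: eq_bigr => j _; ring.
  rewrite hS !e; apply/andP; split; apply: ler_sum => j _; rewrite ler_wpM2l//;
  by case/andP: (IH j).
exists (m' * m), (m^-1 * m'^-1); split; [exact: mulr_gt0|by rewrite mulr_gt0 ?invr_gt0|].
move=> n i; have /andP[b1 b2] := bnd n i; have mun : 0 <= mu ^+ n by exact: exprn_ge0.
apply/andP; split.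
  by apply: le_trans b1; rewrite ler_wpM2r// ler_wpM2l ?(ltW m'0).
by apply: (le_trans b2); rewrite ler_wpM2r// ler_wpM2l ?invr_ge0 ?(ltW m0).
Qed.

(** [eigenvalue] is about row vectors; the determinant, unchanged by transposition, passes from
    columns to rows. *)
Lemma eigenvalue_col (F : fieldType) n (B : 'M[F]_n) mu (s : 'cV[F]_n) :
  s != 0 -> B *m s = mu *: s -> eigenvalue B mu.
Proof.
move=> s0 Bs; apply/eigenvalueP.
have : \det (B - mu%:M) == 0.
  rewrite -det_tr; apply/det0P; exists s^T.
    by apply: contra s0 => /eqP e; rewrite -[s]trmxK e trmx0.
  by rewrite -trmx_mul mulmxBl Bs mul_scalar_mx subrr trmx0.
case/det0P => v v0; rewrite mulmxBr mul_mx_scalar => /eqP.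
by rewrite subr_eq0 => /eqP vB; exists v.
Qed.

(** For a left eigenvector [v] of [a], pairing [|a| |v| <= |v| B] with the positive [s] gives
    [|a| (|v| s) <= mu (|v| s)]. Only [B s <= mu s] is asked, so the bound also serves at
    [y = 0]. *)
Lemma eigenvalue_le (R : realType) n (B : 'M[R]_n) mu a (s : 'cV[R]_n) :
  (forall i j, 0 <= B i j) -> (forall i, 0 < s i 0) ->
  (forall i, (B *m s) i 0 <= mu * s i 0) -> eigenvalue B a -> a <= mu.
Proof.
move=> B0 s0 Bs /eigenvalueP[v vB vn0].
pose S := \sum_i `|v 0 i| * s i 0.
have S0 : 0 < S.
  have /rV0Pn[i vi] := vn0.
  rewrite /S (bigD1 i)//= ltr_pwDl ?mulr_gt0 ?normr_gt0// sumr_ge0// => j _.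
  by rewrite mulr_ge0// ltW.
apply: (le_trans (ler_norm _)); rewrite -(ler_pM2r S0).
apply: (@le_trans _ _ (\sum_j `|v 0 j| * (B *m s) j 0)); last first.
  by rewrite /S mulr_sumr ler_sum// => j _; rewrite mulrCA ler_wpM2l.
under [leRHS]eq_bigr do rewrite mxE mulr_sumr.
rewrite exchange_big /= /S mulr_sumr ler_sum// => i _.
have : `|a * v 0 i| <= \sum_j `|v 0 j| * B j i.
  have -> : a * v 0 i = (v *m B) 0 i by rewrite vB mxE.
  rewrite mxE (le_trans (ler_norm_sum _ _ _))// ler_sum// => j _.
  by rewrite normrM (ger0_norm (B0 _ _)).
rewrite normrM => /(ler_wpM2r (ltW (s0 i))).
by rewrite mulrA mulr_suml => /le_trans; apply; apply: ler_sum => j _; rewrite mulrA.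
Qed.

Lemma sup_maximum (R : realType) (A : set R) m : A m -> ubound A m -> sup A = m.
Proof.
move=> Am ubm; apply/eqP; rewrite eq_le; apply/andP; split.
  by apply: ge_sup => //; exists m.
by apply: ub_le_sup => //; exists m.
Qed.

Lemma map_mx_exp (aR rR : nzRingType) (f : {rmorphism aR -> rR}) n (A : 'M[aR]_n) k :
  map_mx f (A ^+ k) = map_mx f A ^+ k.
Proof.
elim: k => [|k IH]; first by rewrite !expr0 map_mx1.
by rewrite !exprS -IH -!mulmxE map_mxM.
Qed.

Section Graph.
Variables (R : realType) (M : nat) (E : finType).
Variables (src tgt : E -> 'I_M) (lab : E -> bool).

Definition nedges (u v : 'I_M) : R := \sum_(e | (src e == u) && (tgt e == v)) 1.

Lemma nedges_ge0 u v : 0 <= nedges u v.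
Proof. exact: sumr_ge0. Qed.

Lemma sum_nedges (F : 'I_M -> R) u :
  \sum_v nedges u v * F v = \sum_(e | src e == u) F (tgt e).
Proof.
rewrite -(sum_tgt src tgt (fun v _ => F v)); apply: eq_bigr => v _.
by rewrite mulr_suml; apply: eq_bigr => e _; rewrite mul1r.
Qed.

Let AR : 'M[R]_M := map_mx intr (adjmx src tgt).

Lemma ARE u v : AR u v = nedges u v.
Proof. by rewrite !mxE -pmulrn -sum1dep_card natr_sum. Qed.

Lemma AR_pow_gt0 : primitive src tgt ->
  exists2 k, (0 < k)%N & forall u v, 0 < (AR ^+ k) u v.
Proof.
move=> [_ [k [k0 Ak]]]; exists k => // u v.
by rewrite -(map_mx_exp (intr : int -> R)) mxE ltr0z.
Qed.

Lemma adj_perron : primitive src tgt ->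
  exists (lam : R) (xi eta : 'I_M -> R), [/\ 0 < lam, forall u, 0 < xi u,
    forall u, 0 < eta u, forall u, \sum_v nedges u v * xi v = lam * xi u &
    forall v, \sum_u eta u * nedges u v = lam * eta v].
Proof.
move=> prim; have [M0 _] := prim; have [k k0 Ak] := AR_pow_gt0 prim.
have A0 i j : 0 <= AR i j by rewrite ARE nedges_ge0.
have [mu [r [mu0 r0 _ Ar]]] := perron_col M0 A0 Ak.
have [l l0 lA] := perron_left M0 A0 Ak r0 Ar.
have e u : \sum_v nedges u v * r v 0 = mu * r u 0.
  have /matrixP/(_ u 0) := Ar; rewrite !mxE => <-.
  by apply: eq_bigr => v _; rewrite -ARE.
exists mu, (fun u => r u 0), (fun u => l 0 u); split=> //; last first.
  move=> v; have /matrixP/(_ 0 v) := lA; rewrite !mxE => <-.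
  by apply: eq_bigr => u _; rewrite -ARE.
rewrite lt0r mu0 andbT; apply/eqP => mu00.
have AR0 : AR = 0.
  apply/matrixP => u v; rewrite ARE mxE.
  have := e u; rewrite mu00 mul0r => /eqP; rewrite psumr_eq0; last first.
    by move=> w _; rewrite mulr_ge0 ?nedges_ge0// ltW.
  by move=> /allP/(_ v (mem_index_enum _)); rewrite mulf_eq0 (gt_eqF (r0 v)) orbF => /eqP.
have := Ak (Ordinal M0) (Ordinal M0).
by rewrite -(prednK k0) exprS AR0 mul0r mxE ltxx.
Qed.

Notation T y := (Tmat src tgt lab (y : R)).

Lemma Tmat_ge0 y p q : 0 <= y -> 0 <= T y p q.
Proof.
move=> y0; rewrite sumr_ge0// => e _; rewrite sumr_ge0// => e' _.
by rewrite exprn_ge0.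
Qed.

Lemma Tmat1 p q : T 1 p q = nedges p.1 q.1 * nedges p.2 q.2.
Proof.
rewrite /nedges mulr_suml; apply: eq_bigr => e _.
by rewrite mulr_sumr; apply: eq_bigr => e' _; rewrite expr1n mulr1.
Qed.

(** Labels are single bits, so the exponents are 0 or 1. This is the form [K0 + y K1] of the
    perturbation argument. *)
Lemma Tmat_affine y p q : T y p q = T 0 p q + y * (T 1 p q - T 0 p q).
Proof.
rewrite /Tmat -sumrB mulr_sumr -big_split /=; apply: eq_bigr => e _.
rewrite -sumrB mulr_sumr -big_split /=; apply: eq_bigr => e' _.
by case: (_ != _); rewrite ?expr0 ?expr1; ring.
Qed.

Lemma Tmat_le y z p q : 0 <= y -> y <= z -> T y p q <= T z p q.
Proof.
move=> y0 yz; apply: ler_sum => e _; apply: ler_sum => e' _.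
by case: (_ != _); rewrite ?expr0 ?expr1.
Qed.

Lemma Tmat_ge_scaled y z p q : 0 <= z <= 1 -> z <= y -> z * T 1 p q <= T y p q.
Proof.
move=> /andP[z0 z1] zy; rewrite mulr_sumr; apply: ler_sum => e _.
rewrite mulr_sumr; apply: ler_sum => e' _; rewrite expr1n mulr1.
by case: (_ != _); rewrite ?expr0 ?expr1.
Qed.

Definition swap (p : 'I_M * 'I_M) := (p.2, p.1).

Lemma swapK : involutive swap. Proof. by case. Qed.

Lemma Tmat_swap y p q : T y (swap p) (swap q) = T y p q.
Proof.
rewrite /Tmat exchange_big /=; apply: eq_bigr => e _; apply: eq_bigr => e' _.
by rewrite eq_sym.
Qed.

Definition pair_mx y : 'M[R]_#|{: 'I_M * 'I_M}| :=
  \matrix_(i, j) T y (enum_val i) (enum_val j).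

Lemma sum_enum_rank (I : finType) (F : 'I_#|I| -> R) :
  \sum_i F i = \sum_p F (enum_rank p).
Proof. by rewrite (reindex _ (onW_bij _ (@enum_rank_bij I))). Qed.

(** T(1) is the Kronecker square of the adjacency matrix and dominates T(y) from below after scaling
    by [z]. Hence the exponent that makes the adjacency matrix positive also serves for T(y), with
    [z] the minimum of [y] and 1. *)
Lemma pair_mx_pow y z k p q : 0 <= z <= 1 -> z <= y ->
  z ^+ k * ((AR ^+ k) p.1 q.1 * (AR ^+ k) p.2 q.2) <=
  (pair_mx y ^+ k) (enum_rank p) (enum_rank q).
Proof.
move=> z01 zy; have z0 : 0 <= z by case/andP: z01.
have A0 n u v : 0 <= (AR ^+ n) u v.
  elim: n u v => [|n IH] u v; first by rewrite expr0 mxE; case: (_ == _).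
  rewrite exprS -mulmxE mxE sumr_ge0// => w _.
  by rewrite mulr_ge0// ARE nedges_ge0.
elim: k p q => [|k IH] p q.
  rewrite !expr0 mul1r !mxE (inj_eq enum_rank_inj).
  have [<-|pq] := eqVneq p q; first by rewrite !eqxx mulr1.
  case: p q pq => [a b] [c d] pq; rewrite -natrM mulnb /=.
  by move: pq; rewrite xpair_eqE => /negbTE ->.
rewrite !exprS -!mulmxE !mxE mulr_suml mulr_sumr sum_enum_rank.
under eq_bigr do rewrite mulr_sumr mulr_sumr.
rewrite pair_bigA /= ler_sum// => s _.
rewrite [X in _ <= X * _]mxE !enum_rankK.
apply: (@le_trans _ _ ((z * T 1 p s) *
    (z ^+ k * ((AR ^+ k) s.1 q.1 * (AR ^+ k) s.2 q.2)))).
  by rewrite Tmat1 -!ARE le_eqVlt; apply/orP; left; apply/eqP; ring.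
apply: ler_pM => //; last exact: Tmat_ge_scaled.
- by rewrite mulr_ge0// Tmat1 mulr_ge0 ?nedges_ge0.
- by rewrite mulr_ge0 ?exprn_ge0// mulr_ge0.
Qed.

Lemma pair_perron y : primitive src tgt -> 0 < y ->
  exists k, [/\ (0 < k)%N, (0 < #|{: 'I_M * 'I_M}|)%N &
    forall i j, 0 < (pair_mx y ^+ k) i j].
Proof.
move=> prim y0; have [M0 _] := prim; have [k k0 Ak] := AR_pow_gt0 prim.
exists k; split=> //; first by apply/card_gt0P; exists (Ordinal M0, Ordinal M0).
move=> i j; rewrite -[i]enum_valK -[j]enum_valK.
have z0 : 0 < Num.min y 1 by rewrite lt_min y0 ltr01.
apply: lt_le_trans (@pair_mx_pow y (Num.min y 1) k _ _ _ _).
- by rewrite mulr_gt0 ?exprn_gt0// mulr_gt0.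
- by rewrite (ltW z0) ge_min lexx orbT.
- by rewrite ge_min lexx.
Qed.
End Graph.

(** * The dominant eigenvalue of the reduced matrix, and its values at 0 and 1 *)

Section Spectral.
Variables (R : realType) (M : nat) (E : finType).
Variables (src tgt : E -> 'I_M) (lab : E -> bool).

Notation T y := (Tmat src tgt lab (y : R)).
Notation B y := (Bmx src tgt lab (y : R)).
Notation Lam := (@Lam R M E src tgt lab).
Notation A := (nedges R src tgt).

(** The reduction adds the columns of [q] and [swap q], which is the action of T(y) on functions
    invariant under the swap. *)
Lemma sum_Bentry y p (s : 'I_M * 'I_M -> R) : (forall q, s (swap q) = s q) ->
  \sum_(q in V2 M) Bentry src tgt lab y p q * s q = \sum_q T y p q * s q.
Proof.
move=> ss; rewrite [RHS](bigID (mem (V2 M))) /=.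
have -> : \sum_(q | q \notin V2 M) T y p q * s q =
    \sum_(q in V2 M | (q.1 < q.2)%N) T y p (swap q) * s q.
  rewrite (reindex_inj (inv_inj (@swapK M))) /=; apply: eq_big => [q|q _].
    by rewrite !inE /= -ltnNge andbC; case: ltnP => // /ltnW ->.
  by rewrite ss.
rewrite big_mkcondr /= -big_split /=; apply: eq_bigr => q; rewrite inE => qV.
rewrite /Bentry; case: ltnP => q12; first by rewrite mulrDl; case: (q).
rewrite addr0; case: q qV q12 => a b /= ab ba.
suff -> : b = a by [].
by apply: val_inj; apply/eqP; rewrite eqn_leq ba ab.
Qed.

Definition symm (w : 'I_M * 'I_M -> R) q := w q + w (swap q).

Lemma symm_swap w q : symm w (swap q) = symm w q.
Proof. by rewrite /symm swapK addrC. Qed.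

Lemma sum_Tmat_symm y p w :
  \sum_q T y p q * symm w q =
  \sum_q T y p q * w q + \sum_q T y (swap p) q * w q.
Proof.
under eq_bigr do rewrite mulrDr.
rewrite big_split /=; congr (_ + _).
rewrite (reindex_inj (inv_inj (@swapK M))) /=; apply: eq_bigr => q _.
by rewrite swapK -[q in LHS]swapK -[p in LHS]swapK Tmat_swap swapK.
Qed.

Lemma Bmx_col y (w : 'I_M * 'I_M -> R) i :
  (B y *m \col_j symm w (enum_val j)) i 0 =
  \sum_q T y (enum_val i) q * w q + \sum_q T y (swap (enum_val i)) q * w q.
Proof.
rewrite -sum_Tmat_symm -(sum_Bentry y _ (symm_swap w)) big_enum_val mxE.
by apply: eq_bigr => j _; rewrite !mxE.
Qed.

Lemma Bmx_ge0 y i j : 0 <= y -> 0 <= B y i j.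
Proof.
by move=> y0; rewrite mxE /Bentry; case: ifP => _; rewrite ?addr_ge0 ?Tmat_ge0.
Qed.

Lemma eigenvalue_Bmx_le y mu (w : 'I_M * 'I_M -> R) a : 0 <= y ->
  (forall p, 0 < w p) -> (forall p, \sum_q T y p q * w q <= mu * w p) ->
  eigenvalue (B y) a -> a <= mu.
Proof.
move=> y0 w0 Tw; apply: (@eigenvalue_le _ _ _ _ _ (\col_j symm w (enum_val j))).
- by move=> i j; exact: Bmx_ge0.
- by move=> i; rewrite mxE addr_gt0.
- by move=> i; rewrite Bmx_col mxE mulrDr lerD.
Qed.

Lemma diag_V2 (u : 'I_M) : (u, u) \in V2 M.
Proof. by rewrite inE /=. Qed.

Lemma Lam_eq y mu (w : 'I_M * 'I_M -> R) : (0 < M)%N -> 0 <= y ->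
  (forall p, 0 < w p) -> (forall p, \sum_q T y p q * w q = mu * w p) -> Lam y = mu.
Proof.
move=> M0 y0 w0 Tw; apply: sup_maximum => [/=|a /= ev]; last first.
  by apply: (eigenvalue_Bmx_le y0 w0) ev => p; rewrite Tw.
apply: (@eigenvalue_col _ _ _ _ (\col_j symm w (enum_val j))).
  apply/eqP => /matrixP s0.
  have := s0 (enum_rank_in (diag_V2 (Ordinal M0)) (Ordinal M0, Ordinal M0)) 0.
  by rewrite !mxE => /eqP; rewrite gt_eqF// addr_gt0.
by apply/colP => i; rewrite Bmx_col !mxE !Tw mulrDr.
Qed.

Variables (lam : R) (xi eta : 'I_M -> R).
Hypothesis xi0 : forall u, 0 < xi u.
Hypothesis eta0 : forall u, 0 < eta u.
Hypothesis Axi : forall u, \sum_v A u v * xi v = lam * xi u.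
Hypothesis etaA : forall v, \sum_u eta u * A u v = lam * eta v.
Hypothesis M0 : (0 < M)%N.

Lemma Lam1 : Lam 1 = lam ^+ 2.
Proof.
apply: (@Lam_eq _ _ (fun p => xi p.1 * xi p.2)) => // [p|p].
  exact: mulr_gt0.
transitivity (\sum_u \sum_v (A p.1 u * xi u) * (A p.2 v * xi v)).
  rewrite pair_bigA; apply: eq_bigr => q _.
  by rewrite Tmat1 mulrACA.
by rewrite -big_distrlr /= !Axi expr2 mulrACA.
Qed.

(** At [y = 0] only pairs of equally labelled edges count, and an edge from [p.1] has at most one
    such partner leaving [p.2]. *)
Lemma Tmat0_le p : deterministic src lab ->
  \sum_q T 0 p q * xi q.1 <= lam * xi p.1.
Proof.
move=> det; rewrite (sum_Tmat _ _ _ _ _ (fun q => xi q.1)) -Axi sum_nedges.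
apply: ler_sum => e _ /=; rewrite -mulr_suml ger_pMl//.
have [e0 /andP[/eqP s0 /eqP l0]|none] :=
  pickP (fun e' => (src e' == p.2) && (lab e' == lab e)).
  rewrite (bigD1 e0) ?s0//= l0 eqxx expr0 big1 ?addr0// => e' /andP[/eqP s' ne].
  case: eqVneq => [l'|_]; last by rewrite expr1.
  by case/eqP: ne; apply: det; [exact: (etrans s')|exact: (etrans (esym l'))].
rewrite big1// => e' s'; have := none e'; rewrite s' /= => /negbT.
by rewrite eq_sym => ->; rewrite expr1.
Qed.

(** The upper bound comes from the subinvariant function [xi q.1]. The value is attained at a left
    eigenvector supported on the diagonal, with entries [eta]: equally labelled edges leaving the
    same state coincide, so diagonal pairs move only to diagonal pairs, as the adjacency matrix
    prescribes. *)
Lemma Lam0 : deterministic src lab -> Lam 0 = lam.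
Proof.
move=> det; apply: sup_maximum => [/=|a /= ev]; last first.
  by apply: (@eigenvalue_Bmx_le _ _ (fun p => xi p.1)) ev => // p; exact: Tmat0_le.
pose v : 'rV[R]_#|V2 M| :=
  \row_i (if (enum_val i).1 == (enum_val i).2 then eta (enum_val i).1 else 0).
apply/eigenvalueP; exists v; last first.
  pose u0 := Ordinal M0.
  apply/eqP => /matrixP/(_ 0 (enum_rank_in (diag_V2 u0) (u0, u0))).
  rewrite !mxE enum_rankK_in ?diag_V2//= ?eqxx => /eqP.
  by rewrite gt_eqF.
have T0 u q : T 0 (u, u) q = if q.1 == q.2 then A u q.1 else 0.
  rewrite /Tmat /=; case: eqVneq => [<-|q12].
    apply: eq_bigr => e ue; rewrite (bigD1 e)//= eqxx expr0 big1 ?addr0//.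
    move=> e' /andP[/andP[s' t'] ne]; case: eqVneq => [l'|_]; last by rewrite expr1.
    by case/eqP: ne; apply: det; [case/andP: ue => /eqP -> _; apply/eqP|].
  apply: big1 => e /andP[/eqP s t]; apply: big1 => e' /andP[/eqP s' t'].
  case: eqVneq => [l'|_]; last by rewrite expr1.
  have ee : e = e' by apply: det; rewrite ?s ?s'.
  by move: t t' q12; rewrite ee => /eqP <- /eqP <-; rewrite eqxx.
apply/rowP => j; rewrite mxE [RHS]mxE [in RHS]mxE.
set q := enum_val j.
under eq_bigr do rewrite !mxE -/q.
rewrite -(@big_enum_val _ _ _ _ (mem (V2 M)) (fun p : 'I_M * 'I_M =>
  (if p.1 == p.2 then eta p.1 else 0) * Bentry src tgt lab 0 p q)) /=.
transitivity (\sum_u eta u * Bentry src tgt lab 0 (u, u) q).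
  rewrite big_mkcond /=.
  transitivity (\sum_u \sum_v
      (if u == v then eta u * Bentry src tgt lab 0 (u, v) q else 0)).
    rewrite pair_bigA; apply: eq_bigr => -[a b] _ /=.
    rewrite inE /=; case: eqVneq => [<-|_]; first by rewrite leqnn.
    by rewrite mul0r; case: ifP.
  apply: eq_bigr => u _; by rewrite -big_mkcond /= (big_pred1 u).
have : q \in V2 M by exact: enum_valP.
rewrite inE; case: q => a b /= ab; rewrite /Bentry /=.
have [<-|ne] := eqVneq a b.
  by rewrite ltnn -etaA; apply: eq_bigr => u _; rewrite T0 /= eqxx.
rewrite mulr0 big1// => u _; rewrite ltn_neqAle ab andbT ne.
by rewrite !T0 /= (negbTE ne) eq_sym (negbTE ne) addr0 mulr0.
Qed.

(** Serves to let [y] tend to 0, where the bound tends to [lam]. The function [xi q.1] is tested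
    again; each edge has at most [#|E|] partners in the term proportional to [y]. *)
Lemma Lam_le y : deterministic src lab -> 0 <= y -> forall a, eigenvalue (B y) a ->
  a <= lam * (1 + y * #|E|%:R).
Proof.
move=> det y0 a.
apply: (@eigenvalue_Bmx_le _ _ (fun p => xi p.1)) => // p.
under eq_bigr do rewrite Tmat_affine mulrDl.
rewrite big_split /= mulrDr mulr1 mulrDl lerD// ?Tmat0_le//.
apply: (@le_trans _ _ (\sum_q y * (T 1 p q * xi q.1))).
  apply: ler_sum => q _; rewrite -mulrA ler_wpM2l// ler_wpM2r ?(ltW (xi0 _))//.
  by rewrite gerBl Tmat_ge0.
rewrite -mulr_sumr [lam * _]mulrC -!mulrA ler_wpM2l//.
rewrite (sum_Tmat _ _ _ _ _ (fun q => xi q.1)) -Axi sum_nedges mulr_sumr.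
apply: ler_sum => e _ /=; rewrite -mulr_suml ler_wpM2r ?(ltW (xi0 _))//.
under eq_bigr do rewrite expr1n.
by rewrite sumr_const ler_nat max_card.
Qed.

End Spectral.

Section SpectralDerivative.
Variables (R : realType) (M : nat) (E : finType).
Variables (src tgt : E -> 'I_M) (lab : E -> bool).
Notation T y := (Tmat src tgt lab (y : R)).
Notation Lam := (@Lam R M E src tgt lab).

Lemma pair_eigenvector y : primitive src tgt -> 0 < y ->
  exists r : 'cV[R]_#|{: 'I_M * 'I_M}|, [/\ 0 < Lam y, forall i, 0 < r i 0,
    \sum_i r i 0 = 1 & pair_mx src tgt lab y *m r = Lam y *: r].
Proof.
move=> prim y0; have [M0 _] := prim.
have [k [k0 P0 Tk]] := @pair_perron R M E src tgt lab y prim y0.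
have Tp i j : 0 <= pair_mx src tgt lab y i j by rewrite mxE Tmat_ge0// ltW.
have [mu [r [mu0 r0 r1 Tr]]] := perron_col P0 Tp Tk.
have -> : Lam y = mu.
  apply: (@Lam_eq _ _ _ _ _ _ y mu (fun p => r (enum_rank p) 0)) => // [|p].
    exact: ltW.
  have /matrixP/(_ (enum_rank p) 0) := Tr; rewrite mxE [RHS]mxE => <-.
  by rewrite sum_enum_rank; apply: eq_bigr => q _; rewrite mxE !enum_rankK.
exists r; split=> //; rewrite lt0r mu0 andbT; apply/eqP => mu00.
have : pair_mx src tgt lab y ^+ k *m r = 0.
  by rewrite -(prednK k0) exprSr -mulmxE -mulmxA Tr mu00 scale0r mulmx0.
move=> /matrixP/(_ (Ordinal P0) 0); rewrite mxE [RHS]mxE => /eqP.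
rewrite psumr_eq0; last by move=> i _; rewrite mulr_ge0 ?ltW.
move=> /allP/(_ (Ordinal P0) (mem_index_enum _)).
by rewrite gt_eqF// mulr_gt0.
Qed.

Lemma Lam_is_derive (y : R) : primitive src tgt -> 0 < y ->
  exists D, [/\ is_derive y 1 Lam D, 0 <= D & y * D <= Lam y].
Proof.
move=> prim y0.
have [k [_ P0 Tk]] := @pair_perron R M E src tgt lab y prim y0.
pose K1 := pair_mx src tgt lab (1 : R) - pair_mx src tgt lab 0.
have KE z : pair_mx src tgt lab 0 + z *: K1 = pair_mx src tgt lab z.
  by apply/matrixP => i j; rewrite !mxE [RHS]Tmat_affine.
have /choice[r Hr] : forall z, exists r : 'cV[R]_#|{: 'I_M * 'I_M}|, 0 < z ->
    [/\ forall i, 0 < r i 0, \sum_i r i 0 = 1 &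
     (pair_mx src tgt lab 0 + z *: K1) *m r = Lam z *: r].
  move=> z; have [z0|z0] := boolP (0 < z); last by exists 0.
  by have [r [_ r0 r1 Kr]] := pair_eigenvector prim z0; exists r; rewrite KE.
apply: (@perron_is_derive R _ (pair_mx src tgt lab 0) K1 Lam r k y P0 y0).
- by move=> i j; rewrite mxE Tmat_ge0.
- by move=> i j; rewrite !mxE subr_ge0 Tmat_le.
- by rewrite KE.
- exact: Hr.
Qed.

End SpectralDerivative.

(** * The Gilbert-Varshamov curve *)

Lemma cvg_ln_comparable (R : realType) (u v : nat -> R) (c C L : R) :
  0 < c -> 0 < C -> (forall n, 0 <= v n) ->
  (forall n, c * v n <= u n <= C * v n) ->
  ln (v n) / n%:R @[n --> \oo] --> L -> ln (u n) / n%:R @[n --> \oo] --> L.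
Proof.
move=> c0 C0 v0 uv vL.
have d n : `|ln (u n) - ln (v n)| <= `|ln c| + `|ln C|.
  have /andP[h1 h2] := uv n.
  have [vn|vn] := ltrP 0 (v n); last first.
    have vn0 : v n = 0 by apply/eqP; rewrite eq_le vn v0.
    have -> : u n = v n by apply/eqP; move: h1 h2; rewrite vn0 !mulr0 eq_le => -> ->.
    by rewrite subrr normr0 addr_ge0.
  have un : 0 < u n by apply: lt_le_trans h1; rewrite mulr_gt0.
  have l1 : ln c + ln (v n) <= ln (u n).
    by rewrite -lnM ?posrE// ler_ln ?posrE// mulr_gt0.
  have l2 : ln (u n) <= ln C + ln (v n).
    by rewrite -lnM ?posrE// ler_ln ?posrE// mulr_gt0.
  have := ler_norm (ln C); have := ler_norm (- ln c); rewrite normrN.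
  have := normr_ge0 (ln c); have := normr_ge0 (ln C).
  by rewrite ler_norml; lra.
apply/cvgrPdist_le => e e0.
have e20 : 0 < e / 2 by rewrite divr_gt0.
have /cvgrPdist_le/(_ _ e20) vn := vL.
near=> n.
have n0 : 0 < n%:R :> R by near: n; exact: nbhs_infty_gtr.
have h1 : `|L - ln (v n) / n%:R| <= e / 2 by near: n.
have h2 : (`|ln c| + `|ln C|) / (e / 2) <= n%:R.
  by near: n; exact: nbhs_infty_ger.
have -> : L - ln (u n) / n%:R =
    (L - ln (v n) / n%:R) - (ln (u n) - ln (v n)) / n%:R by ring.
rewrite (le_trans (ler_normB _ _))// [e]splitr lerD//.
rewrite normrM normfV (gtr0_norm n0) ler_pdivrMr//.
by rewrite (le_trans (d n))// mulrC -ler_pdivrMr.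
Unshelve. all: by end_near. Qed.

Lemma limn_esup_log2 (R : realType) (u : nat -> R) (L : R) :
  ln (u n) / n%:R @[n --> \oo] --> L ->
  limn_esup (fun n => (log2 (u n) / n%:R)%:E) = (L / ln 2)%:E.
Proof.
move=> uL; apply: (cvg_limn_einf_sup _).2; apply: cvg_EFin; first by near=> n.
rewrite (_ : _ \o _ = fun n => ln (u n) / n%:R * (ln 2)^-1); last first.
  by apply/funext => n; rewrite /= /log2 mulrAC.
by apply: cvgM => //; exact: cvg_cst.
Unshelve. all: by end_near. Qed.

Section Curve.
Variables (R : realType) (M : nat) (E : finType).
Variables (src tgt : E -> 'I_M) (lab : E -> bool).
Notation Lam := (@Lam R M E src tgt lab).
Notation dlt := (@delta_of R M E src tgt lab).
Notation words := (nwords src tgt lab).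
Notation S n := (Sn src tgt lab n).

(** Words are weighted by their number of walks rather than by membership, so that the generating
    function is exactly a sum of entries of powers of T(y). *)
Definition pair_weight n k : R :=
  \sum_(x : n.-tuple bool) \sum_(x' : n.-tuple bool)
    (words x)%:R * (words x')%:R * (dH x x' == k)%:R.

Definition log_Lam (t : R) : R := ln (Lam (expR t)).
Definition tilt (t : R) : R := dlt (expR t).

Lemma pair_weight_ge0 n k : 0 <= pair_weight n k.
Proof.
apply: sumr_ge0 => x _; apply: sumr_ge0 => x' _.
by rewrite !mulr_ge0.
Qed.

Lemma gen_fun_pair_weight n t :
  gen_fun pair_weight n t = \sum_q pair_gf src tgt lab (expR t) n q.
Proof.
rewrite /gen_fun /pair_weight.
under eq_bigr do rewrite mulr_suml.
rewrite exchange_big /= /pair_gf [RHS]exchange_big /=; apply: eq_bigr => x _.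
under eq_bigr do rewrite mulr_suml.
rewrite exchange_big /= [RHS]exchange_big /=; apply: eq_bigr => x' _.
rewrite -mulr_suml; transitivity ((words x)%:R * (words x')%:R * expR t ^+ dH x x').
  have dlt_n : (dH x x' < n.+1)%N by rewrite ltnS dH_le.
  rewrite (bigD1 (Ordinal dlt_n))//= eqxx mulr1 big1 ?addr0.
    by rewrite mulrC [t * _]mulrC expRM_natl mulrC.
  move=> k; rewrite -val_eqE /= eq_sym => /negbTE ->.
  by rewrite mulr0 mul0r.
congr (_ * _); rewrite /nwords !natr_sum big_distrlr /= pair_bigA.
by apply: eq_bigr => -[].
Qed.

Lemma cumul_pair_weight n r : cumul pair_weight n r =
  \sum_(x : n.-tuple bool) \sum_(x' : n.-tuple bool)
    (words x)%:R * (words x')%:R * (dH x x' <= r)%:R.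
Proof.
rewrite /cumul /pair_weight exchange_big /=; apply: eq_bigr => x _.
rewrite exchange_big /=; apply: eq_bigr => x' _.
rewrite -mulr_sumr; congr (_ * _).
have dlt_n : (dH x x' < n.+1)%N by rewrite ltnS dH_le.
rewrite big_mkcond (bigD1 (Ordinal dlt_n))//= eqxx big1 ?addr0.
  by case: (_ <= _)%N.
move=> k; rewrite -val_eqE /= eq_sym => /negbTE ->.
by case: ifP.
Qed.

Lemma TndE n d : (Tnd src tgt lab n d)%:R =
  \sum_(x : n.-tuple bool) \sum_(x' : n.-tuple bool)
    (x \in S n)%:R * (x' \in S n)%:R * (dH x x' <= d.-1)%:R :> R.
Proof.
rewrite /Tnd natr_sum big_mkcond /=; apply: eq_bigr => x _.
case: (x \in S n); last by rewrite big1// => x' _; rewrite !mul0r.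
rewrite /Vball -sum1dep_card natr_sum big_mkcond /=; apply: eq_bigr => x' _.
by rewrite mul1r -natrM mulnb; case: (_ && _).
Qed.

Lemma Tnd_cumul n d : (0 < M)%N -> deterministic src lab ->
  1 * (Tnd src tgt lab n d)%:R <= cumul pair_weight n d.-1
    <= M%:R ^+ 2 * (Tnd src tgt lab n d)%:R.
Proof.
move=> M0 det.
have bw m (x : m.-tuple bool) : ((x \in S m)%:R : R) <= (words x)%:R
    /\ ((words x)%:R : R) <= M%:R * (x \in S m)%:R.
  have /andP[h1 h2] := @nwords_bounds M E src tgt lab m x M0 det.
  by rewrite -natrM !ler_nat.
rewrite mul1r TndE cumul_pair_weight mulr_sumr; apply/andP; split.
  apply: ler_sum => x _; apply: ler_sum => x' _; rewrite ler_wpM2r//.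
  by apply: ler_pM => //; [case: (bw _ x)|case: (bw _ x')].
apply: ler_sum => x _; rewrite mulr_sumr; apply: ler_sum => x' _.
rewrite mulrA ler_wpM2r// expr2 mulrACA.
by apply: ler_pM => //; [case: (bw _ x)|case: (bw _ x')].
Qed.

Hypothesis det : deterministic src lab.
Hypothesis prim : primitive src tgt.

Let M0 : (0 < M)%N. Proof. by case: prim. Qed.

Lemma Lam_gt0 y : 0 < y -> 0 < Lam y.
Proof. by move=> y0; have [r []] := pair_eigenvector lab prim y0. Qed.

Lemma pair_weight_cgf : has_cgf pair_weight log_Lam tilt.
Proof.
split=> [||t]; first exact: pair_weight_ge0.
  move=> t; have y0 : 0 < expR t := expR_gt0 t.
  have [D [HD _ _]] := Lam_is_derive lab prim y0.
  have H1 := @is_derive1_comp R Lam expR t D (expR t) HD (is_derive_expR t).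
  have H2 := @is_derive1_comp R (@ln R) (Lam \o expR) t _ _
    (is_derive1_ln (Lam_gt0 y0)) H1.
  rewrite (_ : log_Lam = @ln R \o (Lam \o expR))//.
  rewrite (_ : tilt t = (Lam (expR t))^-1 * (D * expR t))//.
  by rewrite /tilt /delta_of derive1E derive_val mulrC [D * _]mulrC.
have y0 : 0 < expR t := expR_gt0 t.
have [r [L0 r0 _ Tr]] := pair_eigenvector lab prim y0.
have [|||||c [C [c0 C0 H]]] := @linear_growth R _ (Tmat src tgt lab (expR t))
  (fun p => r (enum_rank p) 0) (Lam (expR t)) (pair_gf src tgt lab (expR t)).
- by move=> p q; rewrite Tmat_ge0 ?expR_ge0.
- by [].
- move=> p; have /matrixP/(_ (enum_rank p) 0) := Tr; rewrite mxE [RHS]mxE => <-.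
  by rewrite sum_enum_rank; apply: eq_bigr => q _; rewrite mxE !enum_rankK.
- by move=> q; exact: pair_gf0.
- by move=> n q; exact: pair_gfS.
have P0 : 0 < #|{: 'I_M * 'I_M}|%:R :> R.
  by rewrite ltr0n; apply/card_gt0P; exists (Ordinal M0, Ordinal M0).
exists (c * #|{: 'I_M * 'I_M}|%:R), (C * #|{: 'I_M * 'I_M}|%:R).
split; [exact: mulr_gt0|exact: mulr_gt0|move=> n].
rewrite gen_fun_pair_weight expRM_natl /log_Lam lnK ?posrE//.
have e a : a * #|{: 'I_M * 'I_M}|%:R * Lam (expR t) ^+ n =
    \sum_(q : 'I_M * 'I_M) a * Lam (expR t) ^+ n.
  by rewrite sumr_const -[RHS]mulr_natr mulrAC.
by rewrite !e; apply/andP; split; apply: ler_sum => q _; case/andP: (H n q).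
Qed.

(** Keeps the parametrized curve over the interval [0,1] on which the GV curve is taken. *)
Lemma delta_of_ge0_le1 y : 0 <= y -> 0 <= dlt y <= 1.
Proof.
rewrite le_eqVlt => /orP[/eqP <-|y0]; first by rewrite /delta_of !mul0r lexx ler01.
have [D [HD D0 DL]] := Lam_is_derive lab prim y0.
rewrite /delta_of derive1E derive_val.
have L0 := Lam_gt0 y0.
by rewrite divr_ge0 ?mulr_ge0 ?(ltW y0) ?(ltW L0)//= ler_pdivrMr// mul1r.
Qed.

Lemma Sn_count n : 1 * #|S n|%:R <= \sum_u word_count R src tgt lab n u
   <= M%:R * #|S n|%:R.
Proof.
have -> : \sum_u word_count R src tgt lab n u =
    \sum_(x : n.-tuple bool) (words x)%:R.
  rewrite exchange_big /=; apply: eq_bigr => x _.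
  by rewrite natr_sum.
have -> : #|S n|%:R = \sum_(x : n.-tuple bool) (x \in S n)%:R :> R.
  rewrite -sum1_card natr_sum big_mkcond /=; apply: eq_bigr => x _.
  by case: (_ \in _).
have bw (x : n.-tuple bool) : ((x \in S n)%:R : R) <= (words x)%:R
    /\ ((words x)%:R : R) <= M%:R * (x \in S n)%:R.
  have /andP[h1 h2] := @nwords_bounds M E src tgt lab n x M0 det.
  by rewrite -natrM !ler_nat.
rewrite mul1r mulr_sumr; apply/andP; split; apply: ler_sum => x _;
by case: (bw x).
Qed.

Lemma perron_Sn : exists lam, [/\ 0 < lam, Lam 0 = lam, Lam 1 = lam ^+ 2,
  forall y, 0 < y -> Lam y <= lam * (1 + y * #|E|%:R) &
  exists c C, [/\ 0 < c, 0 < C &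
    forall n, c * lam ^+ n <= #|S n|%:R <= C * lam ^+ n]].
Proof.
have [lam [xi [eta [lam0 xi0 eta0 Axi etaA]]]] := adj_perron R prim.
have [|||||c [C [c0 C0 H]]] := @linear_growth R _ (nedges R src tgt) xi lam
   (word_count R src tgt lab).
- by move=> u v; exact: nedges_ge0.
- by [].
- by [].
- by move=> u; exact: word_count0.
- by move=> n u; rewrite word_countS sum_nedges.
exists lam; split=> //.
- exact: Lam0 xi0 eta0 Axi etaA M0 det.
- by rewrite (Lam1 lab xi0 Axi M0).
- move=> y y0.
  have bnd := Lam_le xi0 Axi det (ltW y0).
  (* [sup] of an empty set of eigenvalues is 0 by default, and the bound is nonnegative. *)
  rewrite /Defs.Lam.
  have [ne|/nonemptyPn e] :=
    pselect ([set l : R | eigenvalue (Bmx src tgt lab y) l] !=set0).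
    by apply: ge_sup.
  rewrite e sup0 mulr_ge0 ?(ltW lam0)// addr_ge0// mulr_ge0//.
  exact: ltW.
- have Mp : 0 < M%:R :> R by rewrite ltr0n.
  exists (M%:R^-1 * (M%:R * c)), (M%:R * C); split; rewrite ?mulr_gt0 ?invr_gt0//.
  have e a n : M%:R * a * lam ^+ n = \sum_(u < M) a * lam ^+ n.
    by rewrite sumr_const card_ord -[RHS]mulr_natl mulrA.
  move=> n; have /andP[h1 h2] := Sn_count n; rewrite mul1r in h1.
  apply/andP; split.
    rewrite -mulrA ler_pdivrMl// (le_trans _ h2)// e; apply: ler_sum => u _.
    by case/andP: (H n u).
  apply: (le_trans h1); rewrite e; apply: ler_sum => u _.
  by case/andP: (H n u).
Qed.

End Curve.

(** * Exponential rates and the points of the curve *)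

Section Rates.
Variables (R : realType) (M : nat) (E : finType).
Variables (src tgt : E -> 'I_M) (lab : E -> bool).
Notation Lam := (@Lam R M E src tgt lab).
Notation dlt := (@delta_of R M E src tgt lab).
Notation dmax := (delta_max R src tgt lab).
Notation S n := (Sn src tgt lab n).
Notation W := (pair_weight R src tgt lab).
Notation f := (@log_Lam R M E src tgt lab).
Notation df := (@tilt R M E src tgt lab).
Hypothesis det : deterministic src lab.
Hypothesis prim : primitive src tgt.

Let M0 : (0 < M)%N. Proof. by case: prim. Qed.
Let cgf : has_cgf W f df := pair_weight_cgf R lab prim.

Lemma cvg_Tnd (d L : R) :
  ln (cumul W n `|Num.floor (d * n%:R)|%N.-1) / n%:R @[n --> \oo] --> L ->
  Ttilde src tgt lab d = (L / ln 2)%:E.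
Proof.
move=> cL; apply: limn_esup_log2.
have M20 : 0 < (M%:R ^+ 2)^-1 :> R by rewrite invr_gt0 exprn_gt0// ltr0n.
apply: (cvg_ln_comparable M20 ltr01 _ _ cL) => n.
  by apply: sumr_ge0 => k _; exact: pair_weight_ge0.
have /andP[h1 h2] := @Tnd_cumul R M E src tgt lab n `|Num.floor (d * n%:R)|%N M0 det.
rewrite mul1r in h1.
by rewrite mul1r h1 andbT ler_pdivrMl ?exprn_gt0 ?ltr0n.
Qed.

(** The radius [d - 1] is truncated to 0, so each ball is a single word. *)
Lemma Tnd_0 n : Tnd src tgt lab n 0 = #|S n|.
Proof.
rewrite /Tnd -sum1_card; apply: eq_bigr => x xS.
rewrite /Vball (_ : [set y in _ | _]%SET = [set x]%SET) ?cards1//.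
apply/setP => y; rewrite !inE leqn0 dH_eq0 [y == x]eq_sym.
have [<-|_] := eqVneq x y; last by rewrite andbF.
by rewrite andbT; move: xS; rewrite inE.
Qed.

Lemma cvg_Sn lam (c C : R) : 0 < lam -> 0 < c -> 0 < C ->
  (forall n, c * lam ^+ n <= #|S n|%:R <= C * lam ^+ n) ->
  ln (#|S n|%:R : R) / n%:R @[n --> \oo] --> ln lam.
Proof.
move=> lam0 c0 C0 H.
have v0 n : 0 <= lam ^+ n by rewrite exprn_ge0// ltW.
apply: (cvg_ln_comparable c0 C0 v0 H).
apply: cvg_near_cst; near=> n.
have n0 : 0 < n%:R :> R by near: n; exact: nbhs_infty_gtr.
by rewrite lnXn// -[_ *+ n]mulr_natr mulfK// gt_eqF.
Unshelve. all: by end_near. Qed.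

(** The pairs at distance 0 already contribute |S_n| to the generating function. *)
Lemma log_Lam_lower lam c C t : 0 < lam -> 0 < c ->
  (forall n, c * lam ^+ n <= #|S n|%:R <= C * lam ^+ n) ->
  t <= 0 -> ln lam <= f t.
Proof.
move=> lam0 c0 H t0; have [C' C'0 HC] := cumul_upper cgf t0 (lexx 0).
apply: (le_exponential_rate c0 C'0).
near=> n; rewrite expRM_natl lnK ?posrE//.
have /andP[h _] := H n; apply: (le_trans h).
have := HC n; rewrite !mul0r subr0 floor0 /= => /(le_trans _); apply.
have /andP[h1 _] := @Tnd_cumul R M E src tgt lab n 0 M0 det.
by rewrite mul1r Tnd_0 in h1.
Unshelve. all: by end_near. Qed.

(* By convexity, a zero slope at [ln y] makes [ln (Lam y)] the minimum of [f],
   whereas the limit of [Lam z] as [z -> 0] is at most [lam]. *)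
Lemma Lam_flat_le lam y : 0 < lam -> 0 < y -> dlt y = 0 ->
  (forall z, 0 < z -> Lam z <= lam * (1 + z * #|E|%:R)) -> Lam y <= lam.
Proof.
move=> lam0 y0.
have E0 : 0 < #|E|%:R + 1 :> R by rewrite ltr_wpDl.
have z0 e : 0 < e -> 0 < e / (lam * (#|E|%:R + 1)).
  by move=> e0; rewrite divr_gt0// mulr_gt0.
have ze e : 0 < e -> lam * (1 + e / (lam * (#|E|%:R + 1)) * #|E|%:R) <= lam + e.
  move=> e0.
  have -> : lam * (1 + e / (lam * (#|E|%:R + 1)) * #|E|%:R) =
      lam + e * (#|E|%:R / (#|E|%:R + 1)).
    by field; rewrite !gt_eqF.
  by rewrite lerD2l ger_pMr// ler_pdivrMr// mul1r lerDl.
have Lp z : 0 < z -> 0 < Lam z := @Lam_gt0 R M E src tgt lab prim z.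
have fE z : 0 < z -> f (ln z) = ln (Lam z).
  by move=> zp; rewrite /log_Lam lnK.
have dE : df (ln y) = dlt y by rewrite /tilt lnK.
move=> d0 Lle; apply/ler_addgt0Pr => e e0.
apply: le_trans (ze _ e0); apply: le_trans (Lle _ (z0 _ e0)).
have := cgf_tangent (ln (e / (lam * (#|E|%:R + 1)))) (ln y) cgf.
rewrite dE d0 mul0r addr0 (fE _ y0) (fE _ (z0 _ e0)).
by rewrite (ler_ln (Lp _ y0) (Lp _ (z0 _ e0))).
Qed.

(** The last item settles a zero slope at [y > 0]: there the growth rate must agree with the one of
    T(n, 0). *)
Lemma rates : exists lam, [/\ 0 < lam, Lam 0 = lam, Lam 1 = lam ^+ 2 & [/\
  Cap R src tgt lab = (ln lam / ln 2)%:E,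
  Ttilde src tgt lab (0 : R) = (ln lam / ln 2)%:E,
  forall t, t <= 0 -> ln lam <= f t &
  forall y, 0 < y -> y <= 1 -> dlt y = 0 -> Lam y = lam]].
Proof.
have [lam [lam0 L0 L1 Lle [c [C [c0 C0 H]]]]] := perron_Sn R det prim.
have cS := cvg_Sn lam0 c0 C0 H.
have fge t : t <= 0 -> ln lam <= f t := @log_Lam_lower lam c C t lam0 c0 H.
exists lam; split; [exact: lam0|exact: L0|exact: L1|split].
- exact: limn_esup_log2.
- rewrite -(limn_esup_log2 cS) /Ttilde; congr limn_esup.
  by apply/funext => n; rewrite mul0r floor0 Tnd_0.
- exact: fge.
- move=> y y0 y1 d0; apply/eqP; rewrite eq_le.
  rewrite (Lam_flat_le lam0 y0 d0 Lle) /=.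
  have := fge (ln y); rewrite ln_le0 // => /(_ isT).
  rewrite /log_Lam lnK ?posrE// ler_ln ?posrE//.
  exact: Lam_gt0.
Qed.

Lemma delta_of_1 : dlt 1 = dmax.
Proof. by rewrite /delta_of mul1r. Qed.

Lemma R_GV_delta_of y : 0 <= y <= 1 ->
  R_GV src tgt lab (dlt y) = rho_GV src tgt lab y.
Proof.
move=> /andP[+ y1]; have [lam [lam0 L0 L1 [HC HT fge dL]]] := rates.
rewrite le_eqVlt => /orP[/eqP <-|y0].
  (* At [y = 0] the factor [y] makes delta vanish whatever value [derive1] takes there, and both
     sides reduce to [2 Cap - log lam]. *)
  rewrite /R_GV /rho_GV {1}/delta_of mul0r mul0r HT L0.
  by rewrite /delta_of !mul0r add0r EFinN.
have t0 : ln y <= 0 by rewrite ln_le0.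
have fy : f (ln y) = ln (Lam y) by rewrite /log_Lam lnK.
have dy : df (ln y) = dlt y by rewrite /tilt lnK.
have /andP[d0 _] := delta_of_ge0_le1 lab prim (ltW y0).
suff -> : R_GV src tgt lab (dlt y) =
    (2%:E * Cap R src tgt lab - ((ln (Lam y) - dlt y * ln y) / ln 2)%:E)%E.
  rewrite /rho_GV -EFinN; congr (_ + _%:E)%E.
  by rewrite /log2 mulrBl opprB mulrA.
rewrite /R_GV; congr (_ - _)%E.
move: d0; rewrite le_eqVlt => /orP[/eqP d0|d0].
  rewrite -d0 HT (dL y y0 y1 (esym d0)) mul0r subr0; reflexivity.
apply: cvg_Tnd; rewrite -dy -fy; rewrite -dy in d0.
exact: (cumul_rate_tangent cgf fge t0 d0).
Qed.

(** Beyond the slope at 0 the pairs counted have the rate [f 0 = 2 ln lam] of all pairs, twice the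
    capacity. The endpoint delta_max escapes this strict argument and is taken from the curve at
    [y = 1]. *)
Lemma R_GV_top d : 0 <= d -> dmax <= d -> R_GV src tgt lab d = 0%E.
Proof.
move=> d0; have [lam [lam0 L0 L1 [HC HT fge dL]]] := rates.
have l20 : 0 < ln 2 :> R by rewrite ln_gt0// ltr1n.
rewrite le_eqVlt => /orP[/eqP <-|dd].
  rewrite -delta_of_1 R_GV_delta_of ?ler01 ?lexx// /rho_GV HC L1 -EFinM -EFinD.
  congr (_%:E); rewrite /log2 ln1 mul0r mulr0 lnXn// mulr2n; field.
  by rewrite gt_eqF.
have d0' : df 0 < d by rewrite /tilt expR0 delta_of_1.
have := cumul_rate_top cgf d0 d0' => /cvg_Tnd; rewrite /R_GV HC => ->.
rewrite /log_Lam expR0 L1 -EFinM -EFinB; congr (_%:E).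
by rewrite lnXn// mulr2n; field; rewrite gt_eqF.
Qed.

Lemma delta_of_surj d : 0 <= d -> d < dmax -> exists2 y, 0 <= y <= 1 & dlt y = d.
Proof.
rewrite le_eqVlt => /orP[/eqP <- _|d0 dd].
  (* Slope 0 need not occur at any finite [t]; it is attained at [y = 0], which corresponds to no
     [t]. *)
  by exists 0; rewrite ?lexx ?ler01// /delta_of !mul0r.
have dd0 : d < df 0 by rewrite /tilt expR0 delta_of_1.
have [t t0 dt] : exists2 t, t < 0 & df t = d.
  have [lam [_ _ _ [_ _ fge _]]] := rates.
  exact: (cgf_slope_surj cgf fge d0 dd0).
by exists (expR t); rewrite // expR_ge0 -[leRHS]expR0 ler_expR ltW.
Qed.

End Rates.

Theorem theorem1 (R : realType) (M : nat) (E : finType)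
  (src tgt : E -> 'I_M) (lab : E -> bool) :
  deterministic src lab -> primitive src tgt ->
  [set (d, R_GV src tgt lab d) | d in [set d : R | 0 <= d <= 1]] =
  [set (delta_of src tgt lab y, rho_GV src tgt lab y)
     | y in [set y : R | 0 <= y <= 1]]
  `|` [set (d, 0%E) | d in [set d : R | delta_max R src tgt lab <= d <= 1]].
Proof.
move=> det prim; apply/seteqP; split =>
  [_ /= [d /andP[d0 d1] <-]|_ [[y y01 <-]|[d /andP[dd d1] <-]]].
- have [dd|dd] := ltP d (delta_max R src tgt lab).
    have [y y01 <-] := delta_of_surj det prim d0 dd.
    by left; exists y => //; rewrite (R_GV_delta_of det prim).
  by right; exists d; rewrite /= ?dd// (R_GV_top det prim).
- exists (delta_of src tgt lab y).
    by case/andP: y01 => y0 _; exact: delta_of_ge0_le1.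
  by rewrite (R_GV_delta_of det prim).
- have /andP[m0 _] : 0 <= delta_max R src tgt lab <= 1.
    by rewrite -delta_of_1; exact: delta_of_ge0_le1.
  have d0 := le_trans m0 dd.
  by exists d; rewrite /= ?d0 ?d1// (R_GV_top det prim).
Qed.
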